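(* Let $K$ be a commutative ring. Then (1) $E(-1):=\sum_{i\ge 0}(-1)^ie_i=1-G_{(1)}$ in $\widehat\Lambda$; and (2) the linear map $I\colon\Lambda\to\Lambda$ defined by $I(g_\lambda)=\sum_{\mu\subset\lambda}g_\mu$ is invertible and its inverse satisfies $$I^{-1}=E(-1)^\perp=\mathrm{id}_\Lambda-G_{(1)}^\perp=\sum_{i\ge 0}(-1)^ie_i^\perp.$$
   Context: $K$ is a commutative ring. $\Lambda$ is the ring of symmetric formal power series of bounded degree in $x=(x_1,x_2,\dots)$ over $K$; $\widehat\Lambda$ its completion. $e_i$ are the elementary symmetric functions, $s_\lambda$ Schur functions. The Hall inner product $(\,,)\colon\widehat\Lambda\times\Lambda\to K$ is $(\sum a_\lambda s_\lambda,\sum b_\lambda s_\lambda)=\sum a_\lambda b_\lambda$. The coproduct is $\Delta(f)(x,y)=f(x,y)$. For $F\in\widehat\Lambda$, $F^\perp(f)=\sum(F,f_1)f_2$ where $\Delta(f)=\sum f_1\otimes f_2$. For partitions $\mu\subset\lambda$, a reverse plane partition of shape $\lambda/\mu$ is a filling of the boxes by positive integers weakly increasing in rows and columns; $g_{\lambda/\mu}=\sum_T\prod_i x_i^{T(i)}$ over such $T$, with $T(i)$ the number of columns containing $i$; $g_\lambda=g_{\lambda/\emptyset}$. $\{g_\lambda\}$ is a basis of $\Lambda$, and $G_\lambda\in\widehat\Lambda$ (stable Grothendieck polynomials) are defined by $(G_\lambda,g_\mu)=\delta_{\lambda\mu}$. *)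

(* Defs.v *)
From HB Require Import structures.
From mathcomp Require Import all_boot all_order all_algebra finmap monalg.
From mathcomp Require Import boolp classical_sets functions cardinality fsbigop.

Set Implicit Arguments.
Unset Strict Implicit.
Unset Printing Implicit Defensive.

Import GRing.Theory.

Local Open Scope classical_set_scope.
Local Open Scope ring_scope.

(* Infinite sums are written [\sum_(i \in A) F i]: this is the sum over the
   i \in A with F i != 0 when there are finitely many of them.  Sums of power
   series are taken coefficientwise, so this is the usual notion of a sum of a
   locally finite family. *)

(** * Partitions *)

Definition is_partition (s : seq nat) : bool :=
  sorted geq s && all (fun k => 0 < k)%N s.

Record int_part := IntPart {
  parts :> seq nat;
  int_partP : is_partition parts }.

HB.instance Definition _ := [isSub for parts].
HB.instance Definition _ := [Choice of int_part by <:].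

Definition part_empty : int_part := @IntPart [::] isT.
Definition part_one : int_part := @IntPart [:: 1%N] isT.

Definition part_sub (mu lam : int_part) : Prop :=
  forall i, (nth 0 mu i <= nth 0 lam i)%N.

(** * Tableaux *)

Section Tableaux.
Variables lam mu : int_part.

(* The boxes (row, column) of lam / mu; rows and columns are numbered from 0. *)
Definition box : Type :=
  {b : 'I_(size lam) * 'I_(head 0%N lam) | nth 0 mu b.1 <= b.2 < nth 0 lam b.1}%N.

HB.instance Definition _ := Finite.on box.

Definition row_of (b : box) := (val b).1.
Definition col_of (b : box) := (val b).2.

(* The entry k : nat stands for the positive integer k + 1, just as the
   variable of index k stands for x_(k+1). *)
Definition filling : Type := {ffun box -> nat}.

HB.instance Definition _ := Choice.on filling.

Definition is_rpp (T : filling) : Prop :=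
  (forall b c : box, row_of b = row_of c -> (col_of b <= col_of c)%N ->
     (T b <= T c)%N) /\
  (forall b c : box, col_of b = col_of c -> (row_of b <= row_of c)%N ->
     (T b <= T c)%N).

Definition is_ssyt (T : filling) : Prop :=
  (forall b c : box, row_of b = row_of c -> (col_of b <= col_of c)%N ->
     (T b <= T c)%N) /\
  (forall b c : box, col_of b = col_of c -> (row_of b < row_of c)%N ->
     (T b < T c)%N).

Definition num_cols (T : filling) (k : nat) : nat :=
  #|[set j | [exists b : box, (col_of b == j) && (T b == k)]]%SET|.

Definition num_boxes (T : filling) (k : nat) : nat :=
  #|[set b : box | T b == k]%SET|.

End Tableaux.

(** * Power series in infinitely many variables *)

Notation monomial := {cmonom nat}.

Section Series.
Variable K : comPzRingType.

Definition series : Type := monomial -> K.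

Identity Coercion fun_of_series : series >-> Funclass.

HB.instance Definition _ := GRing.Lmodule.copy series (monomial -> K^o).

Definition symmetric_series (f : series) : Prop :=
  forall (s : nat -> nat) (a b : monomial),
    bijective s -> (forall i, b i = a (s i)) -> f a = f b.

Definition bounded_degree (f : series) : Prop :=
  exists d : nat, forall a : monomial, (d < mdeg a)%N -> f a = 0.

Lemma seriesE (c : K) (f g : series) a : (c *: f + g) a = c * f a + g a.
Proof. by []. Qed.

Definition in_Lambda : pred series :=
  [pred f | `[< symmetric_series f /\ bounded_degree f >]].
Definition in_Lambdahat : pred series := [pred f | `[< symmetric_series f >]].

Fact in_Lambda_submod : GRing.submod_closed in_Lambda.
Proof.
split=> [|c f g].
  by apply/asboolP; split=> //; exists 0%N.
move=> /asboolP[fs [m fm]] /asboolP[gs [n gn]]; apply/asboolP; split.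
  by move=> s a b sb ab; rewrite !seriesE (fs s a b) // (gs s a b).
exists (maxn m n) => a; rewrite gtn_max => /andP[ma na].
by rewrite seriesE fm // gn // mulr0 addr0.
Qed.

Fact in_Lambdahat_submod : GRing.submod_closed in_Lambdahat.
Proof.
split=> [|c f g]; first by apply/asboolP.
move=> /asboolP fs /asboolP gs; apply/asboolP => s a b sb ab.
by rewrite !seriesE (fs s a b) // (gs s a b).
Qed.

HB.instance Definition _ :=
  GRing.isSubmodClosed.Build K series in_Lambda in_Lambda_submod.
HB.instance Definition _ :=
  GRing.isSubmodClosed.Build K series in_Lambdahat in_Lambdahat_submod.

Record Lambda := MkLambda {
  Lambda_val :> series;
  LambdaP : Lambda_val \in in_Lambda }.

HB.instance Definition _ := [isSub for Lambda_val].
HB.instance Definition _ := [Choice of Lambda by <:].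
HB.instance Definition _ := [SubChoice_isSubLmodule of Lambda by <:].

(* The completion of Lambda consists of the infinite linear combinations of
   Schur functions, that is, of all symmetric power series. *)
Record Lambdahat := MkLambdahat {
  Lambdahat_val :> series;
  LambdahatP : Lambdahat_val \in in_Lambdahat }.

HB.instance Definition _ := [isSub for Lambdahat_val].
HB.instance Definition _ := [Choice of Lambdahat by <:].
HB.instance Definition _ := [SubChoice_isSubLmodule of Lambdahat by <:].

Fact hat_subproof (f : Lambda) : Lambda_val f \in in_Lambdahat.
Proof. by apply/asboolP; have /asboolP[] := LambdaP f. Qed.

Definition hat (f : Lambda) : Lambdahat := MkLambdahat (hat_subproof f).

Fact sumhat_subproof (I : choiceType) (u : I -> Lambdahat) :
  ((fun a => \sum_(i \in [set: I]) u i a) : series) \in in_Lambdahat.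
Proof.
apply/asboolP => s a b sb ab.
apply: eq_fsbigr => i _; have /asboolP us := LambdahatP (u i); exact: us sb ab.
Qed.

Definition sumhat (I : choiceType) (u : I -> Lambdahat) : Lambdahat :=
  MkLambdahat (sumhat_subproof u).

(** * Elementary symmetric functions, Schur functions *)

(* The monomials of e_i are the squarefree monomials of degree i. *)
Definition e_series (i : nat) : series :=
  fun a => (`[< forall k, (a k <= 1)%N >] && (mdeg a == i))%:R.

Fact e_subproof i : e_series i \in in_Lambda.
Proof.
apply/asboolP; split; last first.
  by exists i => a ia; rewrite /e_series (gtn_eqF ia) andbF.
move=> s a b sb ab.
have sqE : `[< forall k, (a k <= 1)%N >] = `[< forall k, (b k <= 1)%N >].
  case: sb => t st ts; apply: asbool_equiv_eq; split=> H k; first by rewrite ab.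
  by rewrite -[k]ts -ab.
suff degE : mdeg a = mdeg b by rewrite /e_series sqE degE.
have sI := bij_inj sb.
rewrite !mdegE.
have -> : finsupp a = [fset s k | k in finsupp b]%fset.
  case: sb => t st ts; apply/fsetP => k; apply/idP/imfsetP => [ka|[j jb ->]].
    by exists (t k); rewrite ?ts //= mem_finsupp ab ts -mem_finsupp.
  by move: jb; rewrite !mem_finsupp ab.
by rewrite big_imfset /= => [|j l _ _ /sI//]; apply: eq_bigr => k _; rewrite ab.
Qed.

Definition elemsym (i : nat) : Lambda := MkLambda (e_subproof i).

Definition one_series : series := fun a => (mdeg a == 0%N)%:R.

Fact one_subproof : one_series \in in_Lambdahat.
Proof.
have E : one_series = e_series 0.
  apply/funext => a; rewrite /one_series /e_series.
  case: eqP => [/eqP|]; rewrite ?andbF// mdeg_eq0 => /eqP->.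
  by case: asboolP => // -[] k; rewrite cm1.
by have := hat_subproof (elemsym 0); rewrite E.
Qed.

Definition onehat : Lambdahat := MkLambdahat one_subproof.

(* The coefficient of x^a is the number of tableaux T such that x^T = x^a. *)
Definition schur_series (lam : int_part) : series := fun a =>
  \sum_(T \in [set T : filling lam part_empty |
                is_ssyt T /\ forall k, num_boxes T k = a k]) (1 : K).

(** * Hall inner product and coproduct *)

(* Every symmetric power series has exactly one such expansion, so the default
   value of xget is never used. *)
Definition schur_coef (F : Lambdahat) : int_part -> K :=
  xget (fun _ => 0) [set c : int_part -> K |
    forall a, F a = \sum_(lam \in [set: int_part]) c lam * schur_series lam a].

Definition hall (F : Lambdahat) (f : Lambda) : K :=
  \sum_(lam \in [set: int_part]) schur_coef F lam * schur_coef (hat f) lam.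

(* The coefficient of x^a y^b in f(x, y): the variables x_1, y_1, x_2, y_2 and
   so on of f(x, y) are numbered 0, 1, 2, 3 and so on in f. *)
Definition interleave (a b : monomial) : monomial :=
  [cmonom (if odd k then b k./2 else a k./2) |
     k in [fset i.*2 | i in finsupp a] `|` [fset i.*2.+1 | i in finsupp b]]%M.

Definition coprod (f : Lambda) : monomial -> monomial -> K :=
  fun a b => f (interleave a b).

(* A list of pairs (f1, f2) stands for the sum of the f1 (x) f2.  Tensors are
   compared as power series in x and y, which loses nothing as Lambda (x) Lambda
   embeds in these power series (Lambda is free on the monomial symmetric
   functions). *)
Definition is_coprod (f : Lambda) (s : seq (Lambda * Lambda)) : Prop :=
  forall a b, coprod f a b = \sum_(p <- s) p.1 a * p.2 b.

(* A decomposition of coprod f exists, and the value does not depend on which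
   one xget chooses. *)
Definition perp (F : Lambdahat) (f : Lambda) : Lambda :=
  \sum_(p <- xget [::] [set s | is_coprod f s]) hall F p.1 *: p.2.

(** * Dual stable and stable Grothendieck polynomials *)

Definition g_skew_series (lam mu : int_part) : series := fun a =>
  \sum_(T \in [set T : filling lam mu |
                is_rpp T /\ forall k, num_cols T k = a k]) (1 : K).

(* These power series are symmetric and have bounded degree, so that the
   default value 0 of insubd is never used. *)
Definition gpoly (lam : int_part) : Lambda :=
  insubd (0 : Lambda) (g_skew_series lam part_empty).

(* The gpoly mu form a basis of Lambda, so exactly one F has this property; in
   particular the default value 0 of xget is never used. *)
Definition Gpoly (lam : int_part) : Lambdahat :=
  xget 0 [set F | forall mu, hall F (gpoly mu) = (lam == mu)%:R].

Definition Eneg1 : Lambdahat := sumhat (fun i => (-1) ^+ i *: hat (elemsym i)).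

End Series.

(* Main.v *)
(** Let I be the map f |-> f(1, x_1, x_2, ...).  Removing the largest entry of
    a reverse plane partition of shape lambda leaves one of shape mu, for an
    arbitrary mu contained in lambda, and contributes x^(number of columns of
    lambda / mu); at x = 1 this gives I(g_lambda) = sum of the g_mu.  Taking
    top degree parts turns g_lambda into s_lambda and mu into a horizontal
    strip removed from lambda, whence Pieri's rule for I(s_lambda).

    Since E(-1) is the alternating sum of the s_(1^i), that rule shows that
    (E(-1), I f) is the constant term of f: for lambda nonempty, the s_(1^i)
    occurring in I(s_lambda) are either none or two consecutive ones, and their
    contributions cancel.  Taking f = g_lambda and inducting on |lambda|
    gives (E(-1), g_lambda) = [lambda = 0] - [lambda = (1)], that is,
    E(-1) = 1 - G_(1).  The coefficient of y^b in F^perp f is the pairing of F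
    with the coefficient of y^b in f(x, y), an operation that commutes with
    putting a variable equal to 1; so E(-1)^perp inverts I on both sides.

    The symmetry of g_lambda amounts to that of the generating function in
    (t, u) of the nu with mu <= nu <= lambda, weighted by
    t^(columns of lambda / nu) u^(columns of nu / mu).  It is proved one column
    at a time, through an explicit form of the partial sums. *)

From HB Require Import structures.
Require Import Defs.
From mathcomp Require Import all_boot all_order all_algebra.
From mathcomp Require Import boolp classical_sets functions cardinality fsbigop.
From mathcomp Require Import finmap monalg zify ring.

Set Implicit Arguments.
Unset Strict Implicit.
Unset Printing Implicit Defensive.

Import Order.TTheory GRing.Theory Num.Theory.

Local Open Scope classical_set_scope.
Local Open Scope ring_scope.

(** * Reverse plane partitions as chains of partitions *)

Section ColumnLists.
Local Open Scope nat_scope.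

(* Partitions are encoded by their weakly decreasing lists of column heights,
   with trailing zeros allowed. *)
Fixpoint between (ps : seq (nat * nat)) (b : nat) : seq (seq nat) :=
  if ps is p :: ps' then
    flatten [seq [seq y :: r | r <- between ps' y]
            | y <- index_iota p.1 (minn p.2 b).+1]
  else [:: [::]].

(** The bound [sumn k] on the first height excludes nothing, since no height of a smaller shape
    exceeds it. *)
Definition subcols (k : seq nat) := between [seq (0, l) | l <- k] (sumn k).

(** When the boxes of [k] outside of [k'] carry the largest entry, this is the number of columns
    containing it. *)
Definition ndiff (k' k : seq nat) := count (fun p => p.1 < p.2) (zip k' k).

(* The number of reverse plane partitions whose largest entry occupies x
   columns, the next one as many as the next element of [x :: al], and so on. *)
Fixpoint rpp_count (k al : seq nat) : nat :=
  if al is x :: al' then \sum_(k' <- subcols k | ndiff k' k == x) rpp_count k' al'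
  else all (pred1 0) k.

Definition ptleq := all2 leq.

Lemma ptleq_refl k : ptleq k k.
Proof. by elim: k => //= x k ->; rewrite leqnn. Qed.

Lemma ptleq_trans : transitive ptleq.
Proof.
by elim=> [|y s IH] [|x a] [|z b] //= /andP[xy sa] /andP[yz sb];
  rewrite (leq_trans xy yz) IH.
Qed.

Lemma ptleq_size k' k : ptleq k' k -> size k' = size k.
Proof. by rewrite /ptleq all2E => /andP[/eqP]. Qed.

Lemma ptleq_sumn k' k : ptleq k' k -> sumn k' <= sumn k.
Proof. by elim: k' k => [|x k' IH] [|y k] //= /andP[xy /IH]; lia. Qed.

Lemma mem_between ps b r :
  (r \in between ps b) =
  [&& path geq b r, ptleq (unzip1 ps) r & ptleq r (unzip2 ps)].
Proof.
elim: ps b r => [|[m l] ps IH] b [|x r] //=.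
- by rewrite inE /= !andbF.
- by apply/negP => /flattenP[s /mapP[y _ ->] /mapP[r]].
apply/flattenP/idP => [[s /mapP[y]]|].
  rewrite mem_index_iota => yI -> /mapP[r' + [-> ->]]; rewrite IH.
  by case/and3P=> -> -> ->; rewrite !andbT; lia.
case/and3P => /andP[bx xr] /andP[mx mr] /andP[xl rl].
exists [seq x :: r | r <- between ps x].
  by apply/mapP; exists x => //; rewrite mem_index_iota; lia.
by apply/map_f; rewrite IH xr mr rl.
Qed.

Lemma uniq_between ps b : uniq (between ps b).
Proof.
elim: ps b => [|[m l] ps IH] b //=.
apply: allpairs_uniq_dep.
- exact: iota_uniq.
- by move=> y _; apply: IH.
- by move=> [y r] [y' r'] /= _ _ [-> ->].
Qed.

Definition decr (k : seq nat) := sorted geq k.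

Lemma decr_path b k : path geq b k = (all (geq b) k && decr k).
Proof. by rewrite (path_sortedE (rev_trans leq_trans)). Qed.

Lemma mem_subcols k k' : (k' \in subcols k) = decr k' && ptleq k' k.
Proof.
rewrite /subcols mem_between /unzip1 /unzip2 -!map_comp.
rewrite [map (fst \o _) k](eq_map (g := fun=> 0)) //.
rewrite [map (snd \o _) k](eq_map (g := id)) // map_id.
apply/and3P/andP => [[p _ le]|[d le]]; first by rewrite /decr (path_sorted p).
split=> //.
- rewrite decr_path d andbT; apply/allP => x xk /=.
  apply: leq_trans (ptleq_sumn le).
  by elim: (k') xk => //= y s IH; rewrite in_cons => /orP[/eqP->|/IH]; lia.
- by elim: (k) (k') le => [|x s IH] [|y s'] //= /andP[_ /IH].
Qed.

Lemma subcols_decr k k' : k' \in subcols k -> decr k'.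
Proof. by rewrite mem_subcols => /andP[]. Qed.

Lemma subcols_ptleq k k' : k' \in subcols k -> ptleq k' k.
Proof. by rewrite mem_subcols => /andP[]. Qed.

Lemma uniq_subcols k : uniq (subcols k).
Proof. exact: uniq_between. Qed.

Lemma subcols_self k : decr k -> k \in subcols k.
Proof. by rewrite mem_subcols ptleq_refl andbT. Qed.

(** Shapes lying between [k''] and [k] become lists with entrywise lower and upper bounds, the form
    in which the two-variable symmetry is proved. *)
Lemma subcols_between k'' k : decr k'' -> decr k ->
  k'' \in subcols k ->
  perm_eq [seq k' <- subcols k | k'' \in subcols k'] (between (zip k'' k) (sumn k)).
Proof.
move=> d'' d s''; apply: uniq_perm.
- exact/filter_uniq/uniq_subcols.
- exact: uniq_between.
have sz := ptleq_size (subcols_ptleq s'').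
move=> k'; rewrite mem_filter !mem_subcols mem_between unzip1_zip ?unzip2_zip ?sz//.
rewrite d'' /= decr_path.
case: (ptleq k'' k') => //=; last by rewrite !andbF.
case le: (ptleq k' k); rewrite ?andbF// !andbT andb_idl// => _.
apply/allP => x xk /=; apply: leq_trans (ptleq_sumn le).
by elim: (k') xk => //= y s IH; rewrite in_cons => /orP[/eqP->|/IH]; lia.
Qed.

End ColumnLists.

(** * Symmetry in two variables *)

Section Commutation.
Variable R : comPzRingType.
Implicit Types t u : R.

Definition pair_weight t u (ps : seq (nat * nat)) (r : seq nat) : R :=
  t ^+ ndiff r (unzip2 ps) * u ^+ ndiff (unzip1 ps) r.

Definition between_sum t u ps b := \sum_(r <- between ps b) pair_weight t u ps r.

Lemma between_sum_cons t u m l ps b :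
  between_sum t u ((m, l) :: ps) b =
  \sum_(m <= y < (minn l b).+1)
     (t ^+ (y < l)%N * u ^+ (m < y)%N) * between_sum t u ps y.
Proof.
rewrite /between_sum /= big_flatten big_map; apply: eq_bigr => y _.
rewrite big_map big_distrr /=; apply: eq_bigr => r _.
by rewrite /pair_weight /ndiff /= !exprD; ring.
Qed.

Definition chain_pair (p q : nat * nat) := ((q.1 <= p.1) && (q.2 <= p.2))%N.

(* P and Q are the same for (t, u) and (u, t), so that the sums are symmetric
   wherever Q vanishes, in particular beyond the largest height.  The recurrence
   is what makes the induction on the columns go through. *)
Lemma between_sum_split t u ps :
  sorted chain_pair ps -> all (fun p => p.1 <= p.2)%N ps ->
  exists P Q : nat -> R, forall y, ((head (0, 0) ps).1 <= y)%N ->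
    [/\ between_sum t u ps y = P y + t * Q y, between_sum u t ps y = P y + u * Q y,
        P y + (u + t) * Q y + t * u * Q y.+1 = P y.+1 + (u + t) * Q y.+1
      & ((head (0, 0) ps).2 <= y)%N -> Q y = 0 ].
Proof.
elim: ps => [|[m l] ps IH].
  move=> _ _; exists (fun=> 1), (fun=> 0) => y _.
  rewrite /between_sum /= !big_seq1 /pair_weight /ndiff /= !expr0.
  by split=> //; ring.
move=> /= pt /andP[ml al].
have [P [Q PQ]] := IH (path_sorted pt) al.
have hm : ((head (0, 0)%N ps).1 <= m)%N.
  by case: (ps) pt => //= p ps' /andP[/andP[]].
have hl : ((head (0, 0)%N ps).2 <= l)%N.
  by case: (ps) pt => //= p ps' /andP[/andP[]].
move: (head _ ps) PQ hm hl => [m0 l0] /= PQ hm hl.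
(* Where [Q] vanishes, the recurrence makes [P] constant. *)
have tot y : (l <= y)%N -> P y = P l.
  elim: y => [|y IHy]; first by rewrite leqn0 => /eqP->.
  rewrite leq_eqVlt => /orP[/eqP<-//|ly].
  have [|_ _ e q] := PQ y; first lia.
  have [|_ _ _ q'] := PQ y.+1; first lia.
  by rewrite -IHy; last lia; move: e; rewrite q ?q'; try lia; rewrite !mulr0 !addr0.
have Ql y : (l <= y)%N -> Q y = 0.
  by move=> ly; have [|_ _ _ ->//] := PQ y; lia.
(* The recurrence, summed from [m] to [x]. *)
have tele x : (m <= x)%N -> P m + (u + t) * Q m + t * u * \sum_(m.+1 <= y < x.+1)
  Q y
      = P x + (u + t) * Q x.
  elim: x => [|x IHx]; first by rewrite leqn0 => /eqP->; rewrite big_geq//; ring.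
  rewrite leq_eqVlt => /orP[/eqP<-|mx]; first by rewrite big_geq//; ring.
  rewrite big_nat_recr//= mulrDr addrA IHx//.
  by have [|_ _ e _] := PQ x; first lia.
(* When the two bounds agree, the first height is forced and has weight 1, so the sum does not
   depend on [y]. *)
have [Em|lm] := eqVneq m l.
  exists (fun=> P l), (fun=> 0) => y my.
  rewrite !between_sum_cons.
  have -> : minn l y = l by lia.
  rewrite -Em !big_nat1 ltnn !expr0 !mul1r.
  have [|-> -> _ q] := PQ m; first lia.
  by rewrite q; last lia; rewrite -?Em; split=> //; ring.
have {ml lm} ml : (m < l)%N by lia.
(* Below [l], the height [m] contributes [t * S m] and each further height [y] contributes
   [t * u * S y], where [S = P + t Q]. By [tele] the sum of the [Q y] becomes [P x + (u + t) * Q x],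
   up to terms at [m]. From [l] on, the height [l] itself adds [u * P l]. *)
pose P' x := if (x < l)%N then t * u * \sum_(m.+1 <= y < x.+1) P y - t * u * Q m
  else t * u * \sum_(m.+1 <= y < l) P y - t * u * Q m + (u + t) * P l.
pose Q' x := if (x < l)%N then P x + (u + t) * Q x else 0.
(* The pair [s], [v] is [t], [u] in either order: [P'] and [Q'] involve only the sum and the
   product, so one computation serves both. *)
have low (s v : R) x : (m <= x < l)%N ->
    s + v = u + t -> s * v = t * u ->
    (forall y, (m0 <= y)%N -> between_sum s v ps y = P y + s * Q y) ->
    between_sum s v ((m, l) :: ps) x = P' x + s * Q' x.
  move=> /andP[mx xl] sv sv' E.
  rewrite between_sum_cons (_ : minn l x = x); last lia.
  rewrite big_ltn; last lia.
  rewrite ml ltnn expr1 expr0 mulr1 E//.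
  rewrite (eq_big_nat _ _ (F2 := fun y => t * u * P y + s * (t * u * Q y)));
    last first.
    move=> y yI; rewrite -sv' E; last lia.
    have -> : (y < l)%N by lia.
    have -> : (m < y)%N by lia.
    by ring.
  rewrite big_split /= -!mulr_sumr.
  rewrite /P' /Q' xl -tele// -sv -sv'; ring.
have high (s v : R) x : (l <= x)%N ->
    s + v = u + t -> s * v = t * u ->
    (forall y, (m0 <= y)%N -> between_sum s v ps y = P y + s * Q y) ->
    between_sum s v ((m, l) :: ps) x = P' x + s * Q' x.
  move=> lx sv sv' E.
  (* Compared with the bound [l.-1], the only new first height is [l], of weight [v]. *)
  have := low s v l.-1 _ sv sv' E.
  rewrite !between_sum_cons.
  have -> : minn l l.-1 = l.-1 by lia.
  have -> : minn l x = l by lia.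
  rewrite prednK; last lia.
  move=> L; rewrite big_nat_recr /=; last lia.
  rewrite L; last lia.
  rewrite ltnn ml expr0 expr1 mul1r E; last lia.
  rewrite Ql// mulr0 addr0 /P' /Q' (ltnNge x) lx /= prednK; last lia.
  rewrite leqnn mulr0 addr0 -tele; last lia.
  rewrite prednK; last lia.
  have := tele l (ltnW ml).
  rewrite big_nat_recr//= (Ql _ (leqnn l)) addr0 mulr0 addr0 => ->.
  by rewrite -sv; ring.
exists P', Q' => x mx; split.
- have [xl|lx] := ltnP x l; [apply: low|apply: high] => //; try lia;
    by [rewrite addrC | move=> y yI; have [] := PQ y].
- have [xl|lx] := ltnP x l; [apply: low|apply: high] => //; try lia;
    by [rewrite mulrC | move=> y yI; have [] := PQ y].
- rewrite /P' /Q'; have [xl|lx] := ltnP x.+1 l.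
    have -> : (x < l)%N by lia.
    rewrite [in RHS]big_nat_recr /=; last lia.
    have [|_ _ e _] := PQ x; first lia.
    rewrite mulrDr.
    set S := \sum_(_ <= _ < _) _.
    have -> : (u + t) * (P x.+1 + (u + t) * Q x.+1) =
      (u + t) * (P x + (u + t) * Q x + t * u * Q x.+1) by rewrite e.
    by ring.
  have [xl|lx'] := ltnP x l; last by ring.
  have -> : x.+1 = l by lia.
  have -> : P x + (u + t) * Q x = P l.
    have := tele l (ltnW ml).
    rewrite big_nat_recr//= -[in X in X -> _](_ : x.+1 = l); last lia.
    rewrite [Q x.+1]Ql ?addr0 ?mulr0 ?addr0; last lia.
    by rewrite tele// => ->; congr P; lia.
  by ring.
- by move=> lx; rewrite /Q' ltnNge lx.
Qed.

Lemma between_sum_sym t u ps b :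
  sorted chain_pair ps -> all (fun p => p.1 <= p.2)%N ps ->
  ((head (0, 0) ps).2 <= b)%N -> between_sum t u ps b = between_sum u t ps b.
Proof.
move=> cps aps hb; have [P [Q PQ]] := between_sum_split t u cps aps.
have [|-> -> _ ->//] := PQ b; last by rewrite !mulr0.
by apply: leq_trans hb; case: (ps) aps => //= p ps' /andP[].
Qed.

End Commutation.

(** * Symmetry and degree bounds of the chain counts *)

Section ChainCounts.
Local Open Scope nat_scope.

Lemma coef2_mono (a b i j : nat) :
  ((('X^a * ('X^b)%:P : {poly {poly int}})`_i)`_j = ((i == a) && (j == b))%:R)%R.
Proof.
rewrite coefMC coefXn; case: (i == a); rewrite ?mul1r ?mul0r ?coef0//.
by rewrite coefXn.
Qed.

(** Taking two independent polynomial variables over the integers for [t] and [u] turns the symmetry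
    of [between_sum] into an equality of coefficients. *)
Lemma between_count ps c a b :
  sorted chain_pair ps -> all (fun p => p.1 <= p.2) ps ->
  (head (0, 0) ps).2 <= c ->
  count (fun r => (ndiff r (unzip2 ps) == a) && (ndiff (unzip1 ps) r == b))
        (between ps c) =
  count (fun r => (ndiff r (unzip2 ps) == b) && (ndiff (unzip1 ps) r == a))
        (between ps c).
Proof.
move=> cps aps hc.
have E (i j : nat) : (((between_sum 'X ('X%:P : {poly {poly int}}) ps c)`_i)`_j)%R =
   (count (fun r => (ndiff r (unzip2 ps) == i) && (ndiff (unzip1 ps) r == j))
        (between ps c))%:R%R.
  rewrite /between_sum !coef_sum -sum1_count natr_sum [RHS]big_mkcond /=.
  apply: eq_bigr => r _; rewrite /pair_weight -polyC_exp coef2_mono.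
  by rewrite ![_ == ndiff _ _]eq_sym; case: ifP.
have E' (i j : nat) : (((between_sum ('X%:P : {poly {poly int}}) 'X ps
  c)`_i)`_j)%R =
   (count (fun r => (ndiff r (unzip2 ps) == j) && (ndiff (unzip1 ps) r == i))
        (between ps c))%:R%R.
  rewrite /between_sum !coef_sum -sum1_count natr_sum [RHS]big_mkcond /=.
  apply: eq_bigr => r _; rewrite /pair_weight -polyC_exp mulrC coef2_mono.
  by rewrite ![_ == ndiff _ _]eq_sym andbC; case: ifP.
have := E a b; rewrite between_sum_sym// E' => /eqP; rewrite eqr_nat.
by move/eqP=> ->.
Qed.

Lemma decr_zip k' k : decr k' -> decr k -> size k' = size k ->
  sorted chain_pair (zip k' k).
Proof.
case: k' k => [|x k'] [|y k] //= + + [].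
elim: k' k x y => [|x' k' IH] [|y' k] x y //= /andP[xx px] /andP[yy py] [sz].
by rewrite /chain_pair /= IH// andbT; apply/andP.
Qed.

Lemma ptleq_zip k' k : ptleq k' k -> all (fun p => p.1 <= p.2) (zip k' k).
Proof. by elim: k' k => [|x s IH] [|y t] //= /andP[-> /IH]. Qed.

Lemma count_subcols_swap k'' k a b : decr k'' -> decr k -> k'' \in subcols k ->
  count (fun k' => [&& k'' \in subcols k', ndiff k' k == a & ndiff k'' k' == b])
    (subcols k) =
  count (fun k' => [&& k'' \in subcols k', ndiff k' k == b & ndiff k'' k' == a])
    (subcols k).
Proof.
move=> d'' d s''.
have E c e : count (fun k' => [&& k'' \in subcols k',
  ndiff k' k == c & ndiff k'' k' == e]) (subcols k)
  = count (fun r => (ndiff r (unzip2 (zip k'' k)) == c)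
       && (ndiff (unzip1 (zip k'' k)) r == e)) (between (zip k'' k) (sumn k)).
  have sz := ptleq_size (subcols_ptleq s'').
  rewrite unzip1_zip ?unzip2_zip ?sz// -(permP (subcols_between d'' d s''))
    count_filter.
  by apply: eq_count => r /=; rewrite andbC.
rewrite !E; apply: between_count.
- by apply: decr_zip => //; apply/ptleq_size/subcols_ptleq.
- exact/ptleq_zip/subcols_ptleq.
- by case: (k'') (k) => [|x s] [|y t] //=; apply: leq_addr.
Qed.

Lemma subcols_trans k'' k' k : k'' \in subcols k' -> k' \in subcols k ->
  k'' \in subcols k.
Proof.
by rewrite !mem_subcols => /andP[-> l1] /andP[_ l2]; apply: ptleq_trans l1 l2.
Qed.

(** Two successive removals are grouped by the final shape [k'']. Only the middle shape is then
    counted, and there the two column numbers can be exchanged. *)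
Lemma sum_subcols2 (F : seq nat -> nat) k a b : decr k ->
  \sum_(k' <- subcols k | ndiff k' k == a) \sum_(k'' <- subcols k' | ndiff k'' k'
    == b) F k''
  = \sum_(k'' <- subcols k)
      count (fun k' => [&& k'' \in subcols k',
        ndiff k' k == a & ndiff k'' k' == b]) (subcols k) * F k''.
Proof.
move=> d.
under [RHS]eq_bigr => k'' _ do rewrite -sum1_count big_distrl /= big_mkcond /=.
rewrite exchange_big /= big_mkcond /= !big_seq; apply: eq_bigr => k' k'k.
case: ifPn => nd; last first.
  by rewrite big1// => k'' _; rewrite /= andbF.
rewrite (perm_big [seq x <- subcols k | x \in subcols k']) /=; last first.
  apply: uniq_perm; rewrite ?filter_uniq ?uniq_subcols// => x.
  rewrite mem_filter andb_idr// => xk'; exact: subcols_trans xk' k'k.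
rewrite big_filter_cond big_mkcond /=; apply: eq_bigr => k'' _.
by case: ifP => //; rewrite mul1n.
Qed.

Lemma rpp_count_swap k x y al : decr k -> rpp_count k (x :: y :: al) =
  rpp_count k (y :: x :: al).
Proof.
move=> d /=; rewrite !sum_subcols2// !big_seq; apply: eq_bigr => k'' k''k.
by rewrite count_subcols_swap// (subcols_decr k''k).
Qed.

Lemma rpp_count_move k x s1 s2 : decr k -> rpp_count k (s1 ++ x :: s2) =
  rpp_count k (x :: s1 ++ s2).
Proof.
elim: s1 k => // y s1 IH k d; rewrite !cat_cons rpp_count_swap//.
rewrite [LHS]/= [RHS]/= -/rpp_count big_seq_cond [RHS]big_seq_cond.
by apply: eq_bigr => k' /andP[/subcols_decr d' _]; apply: IH.
Qed.

(** The head of [s1] is moved to the front of [s2] by adjacent exchanges, and the tails are compared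
    on the smaller shapes. This is the symmetry of the [g_lambda]. *)
Lemma rpp_count_perm k s1 s2 : decr k -> perm_eq s1 s2 ->
  rpp_count k s1 = rpp_count k s2.
Proof.
move=> + p; elim: s1 s2 p k => [|x s1 IH] s2 p k d.
  by move: p => /perm_size/esym/size0nil ->.
have xs2 : x \in s2 by rewrite -(perm_mem p) mem_head.
case/splitPr: xs2 p => t1 t2 p; rewrite rpp_count_move//=.
rewrite big_seq_cond [RHS]big_seq_cond; apply: eq_bigr => k' /andP[/subcols_decr
  d' _].
apply: IH => //; rewrite -(perm_cons x); apply: perm_trans p _.
by rewrite -(cat1s x t2) -[X in perm_eq _ X]cat1s perm_catCA.
Qed.

Lemma ndiff_eq0 k' k : ptleq k' k -> (ndiff k' k == 0) = (k' == k).
Proof.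
rewrite /ndiff; elim: k' k => [|x s IH] [|y t] //= /andP[xy st].
by rewrite eqseq_cons -IH//; lia.
Qed.

Lemma big_uniq_pred1 (T : eqType) (s : seq T) x (F : T -> nat) :
  uniq s -> x \in s -> \sum_(i <- s | i == x) F i = F x.
Proof.
move=> us xs; rewrite -big_filter (_ : filter _ _ = [:: x]) ?big_seq1//.
exact: filter_pred1_uniq.
Qed.

Lemma rpp_count_0 k al : decr k -> rpp_count k (0 :: al) = rpp_count k al.
Proof.
move=> d; rewrite /= big_seq_cond.
rewrite (eq_bigl (fun k' => (k' \in subcols k) && (k' == k))); last first.
  move=> k'; case s: (k' \in subcols k) => //=; rewrite ndiff_eq0//;
    exact: subcols_ptleq s.
rewrite -big_seq_cond; exact: (big_uniq_pred1 (fun i => rpp_count i al)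
  (uniq_subcols k) (subcols_self d)).
Qed.

Lemma rpp_count_filter0 k al : decr k -> rpp_count k [seq x <- al | 0 < x] =
  rpp_count k al.
Proof.
elim: al k => // x al IH k d; rewrite [filter _ _]/=.
case: x => [|x]; first by rewrite rpp_count_0// IH.
rewrite /= big_seq_cond [RHS]big_seq_cond.
by apply: eq_bigr => k' /andP[/subcols_decr d' _]; apply: IH.
Qed.

(** Each shortened column loses at least one box. *)
Lemma ndiff_sumn k' k : ptleq k' k -> ndiff k' k + sumn k' <= sumn k.
Proof.
rewrite /ndiff; elim: k' k => [|x s IH] [|y t] //= /andP[xy /IH].
by case: (ltnP x y) => /=; lia.
Qed.

Lemma rpp_count_sumn k al : rpp_count k al != 0 -> sumn al <= sumn k.
Proof.
elim: al k => // x al IH k; rewrite [rpp_count _ _]/=.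
rewrite sum_nat_seq_neq0 => /hasP[k' k'k /andP[/eqP nd /IH]] /=.
have := ndiff_sumn (subcols_ptleq k'k); lia.
Qed.

(** Equality in [ndiff_sumn]: for [k'] inside [k], every column loses at most one box, so the
    difference is a horizontal strip. *)
Definition strip k' k := (ndiff k' k + sumn k' == sumn k).

(** When the content has the size of the shape, the bounds [ndiff_sumn] and [rpp_count_sumn] are
    attained together. So in top degree each removal is a horizontal strip, as for semistandard
    tableaux. *)
Lemma rpp_count_strip k x al : sumn (x :: al) = sumn k ->
  rpp_count k (x :: al) = \sum_(k' <- subcols k | strip k' k &&
    (sumn k' == sumn al)) rpp_count k' al.
Proof.
move=> E; rewrite /= big_mkcond [RHS]big_mkcond !big_seq /=;
  apply: eq_bigr => k' k'k.
have := ndiff_sumn (subcols_ptleq k'k); rewrite /strip.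
have := @rpp_count_sumn k' al; move: E => /=.
case: (rpp_count k' al) => [|n]; first by do 2 case: ifP.
move=> E /(_ isT); case: ifP; case: ifP => //; lia.
Qed.

Lemma ndiff_nz k' k : ptleq k' k -> ndiff k' k <= count (leq 1) k.
Proof.
rewrite /ndiff; elim: k' k => [|x s IH] [|y t] //= /andP[xy /IH].
by case: (ltnP x y) => /=; lia.
Qed.

Lemma rpp_count_big k x al : count (leq 1) k < x -> rpp_count k (x :: al) = 0.
Proof.
move=> kx; rewrite /= big_seq_cond big1// => k' /andP[/subcols_ptleq/ndiff_nz +
  /eqP]; lia.
Qed.

Lemma strip_max k' k : ptleq k' k ->
  (strip k' k && (ndiff k' k == count (leq 1) k)) = (k' == map predn k).
Proof.
move=> le; apply/andP/eqP.
  rewrite /strip /ndiff; elim: k' k le => [|x s IH] [|y t] //= /andP[xy st].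
  have := ndiff_sumn st; have := ndiff_nz st; rewrite /ndiff => h1 h2 [/eqP e1
    /eqP e2].
  rewrite -(IH t)//; first by congr (_ :: _); lia.
  by split; apply/eqP; lia.
move=> ->; rewrite /strip /ndiff {le}; elim: k => //= y t [/eqP e1 /eqP e2].
by split; apply/eqP; lia.
Qed.

Lemma decr_pred k : decr k -> decr (map predn k).
Proof. by apply: homo_sorted => x y /=; lia. Qed.

Lemma ptleq_pred k : ptleq (map predn k) k.
Proof. by elim: k => //= x k ->; rewrite leq_pred. Qed.

(** A largest entry that meets every nonempty column must, in top degree, take exactly one box of
    each, so a single shape remains. In terms of rows this deletes the first one ([cols_pred]),
    which drives the inductions for triangularity. *)
Lemma rpp_count_max k al : decr k -> sumn al + count (leq 1) k = sumn k ->
  rpp_count k (count (leq 1) k :: al) = rpp_count (map predn k) al.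
Proof.
move=> d E; rewrite rpp_count_strip /=; last lia.
have ps : map predn k \in subcols k by rewrite mem_subcols decr_pred// ptleq_pred.
rewrite big_seq_cond (eq_bigl (fun k' => (k' \in subcols k) &&
  (k' == map predn k))); last first.
  move=> k'; case s: (k' \in subcols k) => //=;
    rewrite -strip_max ?(subcols_ptleq s)//.
  by rewrite /strip; lia.
rewrite -big_seq_cond; exact: (big_uniq_pred1 (fun i => rpp_count i al)
  (uniq_subcols k) ps).
Qed.

Lemma between_rcons0 ps b :
  between (rcons ps (0, 0)) b = [seq rcons r 0 | r <- between ps b].
Proof.
elim: ps b => [|p ps IH] b /=; first by rewrite min0n.
rewrite map_flatten -map_comp; congr flatten; apply: eq_map => y /=.
by rewrite IH -!map_comp; apply: eq_map.
Qed.

Lemma subcols_rcons0 k : subcols (rcons k 0) = [seq rcons r 0 | r <- subcols k].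
Proof. by rewrite /subcols map_rcons between_rcons0 sumn_rcons addn0. Qed.

Lemma ndiff_rcons0 k' k : size k' = size k ->
  ndiff (rcons k' 0) (rcons k 0) = ndiff k' k.
Proof. by move=> sz; rewrite /ndiff zip_rcons// -cats1 count_cat addn0. Qed.

Lemma rpp_count_rcons0 k al : rpp_count (rcons k 0) al = rpp_count k al.
Proof.
elim: al k => [|x al IH] k /=; first by rewrite all_rcons.
rewrite subcols_rcons0 big_map big_mkcond [RHS]big_mkcond !big_seq.
apply: eq_bigr => k' /subcols_ptleq/ptleq_size sz.
by rewrite ndiff_rcons0// IH.
Qed.

Lemma rpp_count_cat0 k n al : rpp_count (k ++ nseq n 0) al = rpp_count k al.
Proof.
elim: n k => [|n IH] k; first by rewrite cats0.
by rewrite -cat_rcons IH rpp_count_rcons0.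
Qed.

End ChainCounts.

(** * Conjugation and triangularity *)

Section Conjugation.
Local Open Scope nat_scope.

(** The conjugate of the partition [s], cut or padded with zeros to length [n]. *)
Definition cols n (s : seq nat) := mkseq (fun j => count (leq j.+1) s) n.

Lemma count_decr s i j : decr s -> (i < count (leq j.+1) s) = (j < nth 0 s i).
Proof.
elim: s i => [|x s IH] i d; first by rewrite nth_nil.
have := d; rewrite /decr /= decr_path => /andP[/allP sx ds].
case: (ltnP j x) => jx /=; first by case: i => [|i] //=; rewrite -IH.
suff -> : count (leq j.+1) s = 0.
  case: i => [|i] /=; first lia.
  case: (ltnP i (size s)) => [/(mem_nth 0)/sx/=|/(nth_default 0) ->//]; lia.
by apply/eqP; rewrite -leqn0 leqNgt -has_count -all_predC;
  apply/allP => y /sx /=; lia.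
Qed.

Lemma size_cols n s : size (cols n s) = n.
Proof. exact: size_mkseq. Qed.

Lemma nth_cols n s j : j < n -> nth 0 (cols n s) j = count (leq j.+1) s.
Proof. exact: nth_mkseq. Qed.

Lemma decr_cols n s : decr (cols n s).
Proof.
apply: (homo_sorted (e := leq)); last exact: iota_sorted.
by move=> x y /= xy; apply: sub_count => z /=; lia.
Qed.

Lemma colsE n s i j : decr s -> (i < nth 0 (cols n s) j) =
  (j < n) && (j < nth 0 s i).
Proof.
move=> d; case: (ltnP j n) => jn /=; first by rewrite nth_cols// count_decr.
by rewrite nth_default ?size_cols.
Qed.

Lemma nth_le_head s i : decr s -> nth 0 s i <= head 0 s.
Proof.
case: s => [|x s]; first by rewrite nth_nil.
rewrite /decr /= decr_path => /andP[/allP sx ds].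
case: (ltnP i (size (x :: s))) => [/(mem_nth 0)|/(nth_default 0) ->//].
by rewrite inE => /orP[/eqP->//|/sx].
Qed.

Lemma colsK n s : decr s -> head 0 s <= n -> cols (size s) (cols n s) = s.
Proof.
move=> d hn; apply: (@eq_from_nth _ 0); rewrite ?size_cols// => i si.
apply/eqP; rewrite eqn_leq; apply/andP; split; rewrite leqNgt; apply/negP.
  rewrite colsE ?decr_cols// si /= colsE// ltnn andbF//.
(* Here [j] will be the last column met by row [i]; its box lies in [s], hence in the double
   conjugate. *)
move=> H; have := H; rewrite -(ltn_predK H) ltnS.
move: (nth 0 s i).-1 (ltn_predK H) => j js.
have {}js : j < nth 0 s i by rewrite -js.
have := colsE (size s) j i (decr_cols n s); rewrite si (colsE n i j d) js andbT /=.
have := nth_le_head i d; lia.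
Qed.

Lemma sumn_cols n s : all (geq n) s -> sumn (cols n s) = sumn s.
Proof.
move=> /allP sn; rewrite sumnE big_map.
under eq_bigr do rewrite -sum1_count big_mkcond /=.
rewrite exchange_big /= sumnE !big_seq; apply: eq_bigr => x /sn /= xn.
rewrite -big_mkcond /= sum1_count -(subnKC xn) iotaD count_cat.
rewrite (@eq_in_count _ _ predT) ?count_predT ?size_iota; last first.
  by move=> i; rewrite mem_iota /=; lia.
rewrite (@eq_in_count _ _ pred0) ?count_pred0 ?addn0// => i.
by rewrite mem_iota /=; lia.
Qed.

Lemma cols_cat0 n m s : all (geq n) s -> cols (n + m) s = cols n s ++ nseq m 0.
Proof.
move=> /allP sn; rewrite /cols /mkseq iotaD map_cat; congr (_ ++ _).
apply: (@eq_from_nth _ 0); first by rewrite size_map size_iota size_nseq.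
move=> i; rewrite size_map size_iota => im.
rewrite (nth_map 0) ?size_iota// nth_iota// nth_nseq im; apply/eqP;
  rewrite -leqn0 leqNgt -has_count -all_predC.
by apply/allP => y /sn /=; lia.
Qed.

Lemma cols_pred n x s : decr (x :: s) -> map predn (cols n (x :: s)) = cols n s.
Proof.
rewrite /decr /= decr_path => /andP[/allP sx ds].
rewrite /cols /mkseq -map_comp; apply: eq_map => j /=.
case: (ltnP j x) => //= jx; suff -> : count (leq j.+1) s = 0 by [].
by apply/eqP; rewrite -leqn0 leqNgt -has_count -all_predC;
  apply/allP => y /sx /=; lia.
Qed.

Lemma count_cols n x s : x <= n -> decr (x :: s) ->
  count (leq 1) (cols n (x :: s)) = x.
Proof.
move=> xn; rewrite /decr /= decr_path => /andP[/allP sx ds].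
rewrite /cols /mkseq count_map -(subnKC xn) iotaD count_cat.
rewrite (@eq_in_count _ _ predT) ?count_predT ?size_iota; last first.
  by move=> i; rewrite mem_iota /=; lia.
rewrite (@eq_in_count _ _ pred0) ?count_pred0 ?addn0// => i.
rewrite mem_iota /= => iI; apply/negbTE; rewrite -leqNgt leqn0 addn_eq0 eqb0.
apply/andP; split; first lia.
rewrite -leqn0 leqNgt -has_count -all_predC; apply/allP => y /sx /=; lia.
Qed.

(** Each part in turn equals the number of nonempty columns left, the largest possible value, so the
    rows are removed one at a time and without choice. *)
Lemma rpp_count_diag n s : decr s -> all (geq n) s -> rpp_count (cols n s) s = 1.
Proof.
elim: s => [|x s IH] d sn.
  by rewrite /= (_ : all _ _) //; apply/allP => y /mapP[i _ ->].
have /andP[xn sn'] := sn.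
have ds : decr s by apply: path_sorted d.
have cx := count_cols xn d.
rewrite -{2}cx rpp_count_max ?decr_cols//; first by rewrite cols_pred// IH.
by rewrite cx sumn_cols//= addnC.
Qed.

Fixpoint lexleq (s t : seq nat) : bool :=
  match s, t with
  | x :: s', y :: t' => (x < y) || ((x == y) && lexleq s' t')
  | [::], _ => true
  | _, [::] => false
  end.

Lemma lexleq_anti : antisymmetric lexleq.
Proof.
elim=> [|x s IH] [|y t] //= H; have xy : x = y by lia.
by move: H; rewrite xy ltnn eqxx /= => /IH ->.
Qed.

Lemma lexleq_trans : transitive lexleq.
Proof.
elim=> [|y t IH] [|x s] [|z u] //= /orP[xy|/andP[/eqP-> st]] /orP[yz|/andP[/eqP<-
  tu]].
- by rewrite (ltn_trans xy yz).
- by rewrite xy.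
- by rewrite yz.
- by rewrite eqxx (IH _ _ st tu) orbT.
Qed.

Lemma lexleq_total : total lexleq.
Proof. by elim=> [|x s IH] [|y t] //=; have := IH t; lia. Qed.

(** A first part of [t] exceeding the first row makes the count zero ([rpp_count_big]); an equal one
    removes that row, after which the tails are compared. *)
Lemma rpp_count_lex n s t : decr s -> all (geq n) s -> all (leq 1) t ->
  sumn s = sumn t ->
  rpp_count (cols n s) t != 0 -> lexleq t s.
Proof.
elim: t s => // y t IH [|x s] d sn /= /andP[y1 tp] E; first lia.
have /andP[xn sn'] := sn.
have ds : decr s by apply: path_sorted d.
have cx := count_cols xn d.
change (rpp_count (cols n (x :: s)) (y :: t) != 0 -> lexleq (y :: t) (x :: s)).
case: (ltngtP y x) => [yx|xy|yx]; first by rewrite /= yx.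
  by rewrite rpp_count_big// cx.
move: E; rewrite yx => E; rewrite -{2}cx rpp_count_max ?decr_cols//; last first.
  by rewrite cx sumn_cols //= E addnC.
rewrite cols_pred// /= ltnn eqxx /= => /IH -> //.
by move: E => /= /addnI.
Qed.

End Conjugation.

(** * Counting fillings *)

Section CardLemmas.
Local Open Scope nat_scope.

Lemma bij_on_card (T1 T2 : finType) (A : pred T1) (B : pred T2) (f : T1 -> T2) g :
  (forall x, A x -> B (f x)) -> (forall y, B y -> A (g y)) ->
  (forall x, A x -> g (f x) = x) -> (forall y, B y -> f (g y) = y) ->
  #|A| = #|B|.
Proof.
move=> AB BA fK gK; rewrite -!sum1_card [RHS](reindex_onto f g) /=;
  last by move=> y /gK.
apply: eq_bigl => x; rewrite !unfold_in /=; apply/idP/andP => [Ax|[Bx /eqP<-]].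
  by rewrite fK// AB.
exact: BA.
Qed.

Lemma card_ord_count c (P : pred nat) : #|[set j : 'I_c | P j]%SET| =
  count P (iota 0 c).
Proof.
by rewrite cardsE cardE -val_enum_ord count_map -size_filter enumT.
Qed.

Lemma card_ord_lt c m : m <= c -> #|[set j : 'I_c | j < m]%SET| = m.
Proof.
move=> mc; rewrite (card_ord_count c (fun j => j < m)) -(subnKC mc) iotaD count_cat.
rewrite (@eq_in_count _ _ predT) ?count_predT ?size_iota; last first.
  by move=> i; rewrite mem_iota /=; lia.
rewrite (@eq_in_count _ _ pred0) ?count_pred0 ?addn0// => i.
by rewrite mem_iota /=; lia.
Qed.

Lemma card_initial r (P : pred 'I_r) :
  (forall i i' : 'I_r, i <= i' -> P i' -> P i) -> forall i,
    P i = (i < #|[set i | P i]%SET|).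
Proof.
move=> dn i; apply/idP/idP => [Pi|].
  rewrite -{1}(card_ord_lt (ltn_ord i)); apply/subset_leq_card/fintype.subsetP => j.
  by rewrite !inE ltnS => /dn; apply.
apply: contraTT => nPi; rewrite -leqNgt -[X in _ <= X](card_ord_lt (ltnW (ltn_ord
  i))).
apply/subset_leq_card/fintype.subsetP => j; rewrite !inE => Pj.
by rewrite ltnNge; apply: contra nPi => ij; apply: dn Pj.
Qed.

Lemma ptleqP s t : size s = size t -> (forall i,
  nth 0 s i <= nth 0 t i) -> ptleq s t.
Proof.
elim: s t => [|x s IH] [|y t] //= [sz] H; rewrite (H 0) /= IH// => i;
  exact: (H i.+1).
Qed.

Lemma ptleq_nth s t i : ptleq s t -> nth 0 s i <= nth 0 t i.
Proof. by elim: s t i => [|x s IH] [|y t] [|i] //= /andP[xy /IH]. Qed.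

Lemma ndiff_count k' k : size k' = size k ->
  ndiff k' k = count (fun j => nth 0 k' j < nth 0 k j) (iota 0 (size k)).
Proof.
rewrite /ndiff; elim: k' k => [|x s IH] [|y t] //= [sz].
by rewrite IH// (iotaDl 1) count_map.
Qed.

End CardLemmas.

(** * Reverse plane partitions inside a rectangle *)

Section RectFillings.
Local Open Scope nat_scope.
Variables r c M : nat.
Notation rect := {ffun 'I_r * 'I_c -> 'I_M.+1}.
Implicit Types (T : rect) (k al : seq nat).

Definition rect_mono T := forall p q : 'I_r * 'I_c,
  p.1 <= q.1 -> p.2 <= q.2 -> T p <= T q.

Definition ncol T x := #|[set j | [exists i, T (i, j) == x :> nat]]%SET|.

(* A reverse plane partition is extended to a rectangle by the value [size al]
   outside of its shape. *)
Definition is_rect_rpp k al T :=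
  [&& [forall p : 'I_r * 'I_c, forall q : 'I_r * 'I_c,
    (p.1 <= q.1) ==> (p.2 <= q.2) ==> (T p <= T q)],
      [forall p : 'I_r * 'I_c, (T p <= size al) &&
        ((T p < size al) == (p.1 < nth 0 k p.2))]
    & [forall x : 'I_(size al), ncol T x == nth 0 (rev al) x]].

Lemma is_rect_rppP k al T :
  reflect [/\ rect_mono T, forall p : 'I_r * 'I_c, T p <= size al,
              forall p : 'I_r * 'I_c, (T p < size al) = (p.1 < nth 0 k p.2)
            & forall x, x < size al -> ncol T x = nth 0 (rev al) x]
          (is_rect_rpp k al T).
Proof.
apply: (iffP and3P) => [[/'forall_forallP m /forallP b /forallP x]|[m b s x]];
  split.
- by move=> p q pq1 pq2; have := m p q; rewrite pq1 pq2.
- by move=> p; have /andP[] := b p.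
- by move=> p; have /andP[_ /eqP] := b p.
- by move=> y yn; apply/eqP; exact: x (Ordinal yn).
- by apply/'forall_forallP => p q; apply/implyP => h1; apply/implyP => h2; apply: m.
- by apply/forallP => p; rewrite b s eqxx.
- by apply/forallP => y; rewrite x.
Qed.

(** In a monotone filling the entries below [m] form a shape, and these are its column heights. *)
Definition heights T m := [seq #|[set i | T (i, j) < m]%SET| | j <- enum 'I_c].

Lemma size_heights T m : size (heights T m) = c.
Proof. by rewrite size_map size_enum_ord. Qed.

Lemma nth_heights T m (j : 'I_c) : nth 0 (heights T m) j = #|[set i | T (i,
  j) < m]%SET|.
Proof. by rewrite (nth_map j) ?size_enum_ord// nth_ord_enum. Qed.

Lemma heightsP T m (i : 'I_r) (j : 'I_c) : rect_mono T -> (T (i,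
  j) < m) = (i < nth 0 (heights T m) j).
Proof.
move=> mT; rewrite nth_heights -(card_initial (P := fun i => T (i, j) < m))//.
by move=> i1 i2 i12; apply: leq_ltn_trans; apply: mT.
Qed.

Lemma decr_heights T m : rect_mono T -> decr (heights T m).
Proof.
move=> mT; apply: (homo_sorted (e := fun i j : 'I_c => i <= j)); last first.
  by have := iota_sorted 0 c; rewrite -val_enum_ord sorted_map.
move=> j j' jj' /=; apply/subset_leq_card/fintype.subsetP => i; rewrite !inE.
by apply: leq_ltn_trans; apply: mT.
Qed.

(** Deletes the largest entry [n]: it is merged with the outside, whose value drops from [n.+1] to
    [n]. *)
Definition lower n T : rect := [ffun p => inord (minn (T p) n)].
(** Inverse of [lower n]: among the positions of value [n], those in [k] keep it as a genuine entry
    and the others get [n.+1], the new outside value. *)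
Definition raise k n T : rect :=
  [ffun p => inord (if (n <= T p) && ~~ (p.1 < nth 0 k p.2) then n.+1 else T p)].

Lemma lowerE n T (p : 'I_r * 'I_c) : lower n T p = minn (T p) n :> nat.
Proof. by rewrite ffunE inordK// (leq_ltn_trans (geq_minl _ _)). Qed.

Lemma raiseE k n T (p : 'I_r * 'I_c) : n < M ->
  raise k n T p = (if (n <= T p) && ~~ (p.1 < nth 0 k p.2) then n.+1 else T p) :>
    nat.
Proof. by move=> nM; rewrite ffunE inordK//; case: ifP. Qed.

Lemma eq_rect T T' : (forall p : 'I_r * 'I_c, T p = T' p :> nat) -> T = T'.
Proof. by move=> e; apply/ffunP => p; apply/val_inj/e. Qed.

(** The bijection deletes or restores the largest entry, by [lower] and [raise]. *)
Lemma card_rect_fiber k k' x al :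
  decr k -> size k = c -> all (geq r) k -> size al < M -> k' \in subcols k ->
  ndiff k' k = x ->
  #|[pred T | is_rect_rpp k (x :: al) T && (heights T (size al) == k')]|
  = #|[pred T | is_rect_rpp k' al T]|.
Proof.
move=> d sk kr nM k'k xE; set n := size al in nM *.
have d' := subcols_decr k'k; have le := subcols_ptleq k'k.
have sk' : size k' = c by rewrite (ptleq_size le).
have kr' (j : 'I_c) : nth 0 k j <= r by apply: (allP kr); rewrite mem_nth// sk.
suff [A1 A2 A3 A4] :
  [/\ forall T, is_rect_rpp k (x :: al) T && (heights T n == k') ->
    is_rect_rpp k' al (lower n T),
      forall T, is_rect_rpp k' al T ->
        is_rect_rpp k (x :: al) (raise k n T) && (heights (raise k n T) n == k'),
      forall T, is_rect_rpp k (x :: al) T && (heights T n == k') ->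
        raise k n (lower n T) = T
    & forall T, is_rect_rpp k' al T -> lower n (raise k n T) = T].
  exact: bij_on_card A1 A2 A3 A4.
split=> T.
- case/andP=> /is_rect_rppP[m b s ct] /eqP hE; apply/is_rect_rppP; split.
  + by move=> p q h1 h2; rewrite !lowerE; have := m p q h1 h2; lia.
  + by move=> p; rewrite lowerE geq_minr.
  + by move=> [i j]; rewrite lowerE /= gtn_min ltnn orbF heightsP// hE.
  + move=> y yn; have := ct y (ltnW yn); rewrite rev_cons nth_rcons size_rev yn
    => <-.
    apply: eq_card => j; rewrite !inE; apply: eq_existsb => i; rewrite lowerE.
    by apply/eqP/eqP; rewrite -/n in yn; lia.
- move/is_rect_rppP => [m b s ct].
  have low (p : 'I_r * 'I_c) : p.1 < nth 0 k' p.2 -> p.1 < nth 0 k p.2.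
    by move=> h; apply: leq_trans h (ptleq_nth _ le).
  (* A raised position must not precede one that keeps the value [n]: since [k] decreases, all
     positions below and to the right of one outside [k] are outside as well. *)
  have mR : rect_mono (raise k n T).
    move=> p q h1 h2; rewrite !raiseE//; have := m p q h1 h2.
    case: ifP => [/andP[p1 p2]|_].
      2: by case: ifP => // _; have := b q; rewrite -/n; lia.
    suff -> : (n <= T q) && ~~ (q.1 < nth 0 k q.2) by [].
    rewrite (leq_trans p1)//=; last exact: m.
    apply: contra p2 => q2; apply: leq_ltn_trans h1 (leq_trans q2 _).
    have := h2; rewrite leq_eqVlt => /orP[/eqP->//|pq].
    have pk : p.2 < size k by rewrite sk.
    have qk : q.2 < size k by rewrite sk.
    exact: (sorted_leq_nth (rev_trans leq_trans) leqnn 0 d).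
  have lt (p : 'I_r * 'I_c) : (raise k n T p < n) = (T p < n).
    by rewrite raiseE//; case: ifP => // /andP[h _]; lia.
  have hE : heights (raise k n T) n = k'.
    apply: (@eq_from_nth _ 0); rewrite size_heights ?sk'// => j jc.
    apply/eqP; rewrite (nth_heights _ _ (Ordinal jc)).
    rewrite (eq_card (B := [set i : 'I_r | i < nth 0 k' j]%SET)); last first.
      by move=> i; rewrite !inE lt s.
    rewrite card_ord_lt//; apply: leq_trans (ptleq_nth j le) _.
    exact: (kr' (Ordinal jc)).
  rewrite /= hE eqxx andbT; apply/is_rect_rppP; split=> //=.
  + by move=> p; rewrite raiseE//; case: ifP => //; have := b p; rewrite -/n; lia.
  + move=> p; rewrite raiseE// -/n; case: ifP => [/andP[_ /negbTE->]|]; first lia.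
    have := b p; have := s p; have := low p; rewrite -/n.
    case: (p.1 < nth 0 k p.2); case: (p.1 < nth 0 k' p.2); lia.
  + move=> y yn; rewrite rev_cons nth_rcons size_rev -/n.
    case: ltnP => [yn'|ny].
      rewrite -ct//; apply: eq_card => j; rewrite !inE; apply: eq_existsb => i.
      rewrite raiseE//; case: ifP => // /andP[h _].
      by apply/eqP/eqP; lia.
    (* The entry [n] occurs exactly in the columns where [k] is longer than [k']. *)
    have -> : y = n by rewrite -/n in yn; lia.
    rewrite eqxx -xE ndiff_count ?sk'// sk -card_ord_count.
    apply: eq_card => j; rewrite !inE; apply/existsP/idP => [[i /eqP]|jj].
      rewrite raiseE//; have := b (i, j); have := s (i, j); rewrite /= -/n.
      case: ifP => /=; first lia.
      case: ltnP; case: (ltnP i (nth 0 k j)); lia.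
    have ir : nth 0 k' j < r by apply: leq_trans jj (kr' j).
    (* The witness is the box of column [j] directly below [k']. *)
    exists (Ordinal ir); rewrite raiseE//= jj andbF.
    have := b (Ordinal ir, j); have := s (Ordinal ir, j); rewrite /= ltnn -/n; lia.
- case/andP=> /is_rect_rppP[m b s ct] /eqP hE; apply: eq_rect => p.
  rewrite raiseE// lowerE; have := b p; have := s p; rewrite /= -/n.
  case: ifP => [/andP[h1 h2]|]; first by case: (p.1 < nth 0 k p.2) h2; lia.
  case: (p.1 < nth 0 k p.2); lia.
- move/is_rect_rppP => [m b s ct]; apply: eq_rect => p.
  rewrite lowerE raiseE//; have := b p; rewrite -/n.
  by case: ifP => //; lia.
Qed.

(** Fillings are sorted by the shape that the entries below [size al] form. If [ndiff] from that
    shape to [k] differs from [x], the largest entry would meet a wrong number of columns and the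
    fiber is empty. *)
Lemma card_rect k al : decr k -> size k = c -> all (geq r) k -> size al <= M ->
  #|[pred T | is_rect_rpp k al T]| = rpp_count k al.
Proof.
elim: al k => [|x al IH] k d sk kr nM.
  rewrite /=; case: allP => [z|nz].
    transitivity #|pred1 ([ffun=> ord0] : rect)|; last by rewrite card1.
    apply: eq_card => T; rewrite !inE; apply/is_rect_rppP/eqP => [[_ b _ _]|->].
      by apply: eq_rect => p; rewrite ffunE /=; have := b p; rewrite /=; lia.
    split=> // [p q|p|p]; rewrite ?ffunE//=.
    by rewrite (eqP (z (nth 0 k p.2) _)) ?mem_nth ?sk.
  apply: eq_card0 => T; rewrite !inE; apply/negP => /is_rect_rppP[_ _ s _].
  apply: nz => y yk; apply/eqP; case: (posnP y) => // y0.
  have jc : index y k < c by rewrite -sk index_mem.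
  have ir : 0 < r by apply: leq_trans y0 (allP kr _ yk).
  by have := s (Ordinal ir, Ordinal jc); rewrite /= nth_index// y0.
rewrite [RHS]/= big_mkcond /= big_seq.
rewrite (eq_bigr (fun k' => #|[pred T | is_rect_rpp k (x :: al) T
                         && (heights T (size al) == k')]|)); last first.
  move=> k' k'k; case: eqP => [xE|nE].
    rewrite (card_rect_fiber (k' := k') d)// IH ?(subcols_decr k'k)//.
    + by rewrite (ptleq_size (subcols_ptleq k'k)).
    + apply/(all_nthP 0) => i; rewrite (ptleq_size (subcols_ptleq k'k)) => ik /=.
      apply: leq_trans (ptleq_nth i (subcols_ptleq k'k)) _.
      by apply: (allP kr); apply: mem_nth.
    + exact: ltnW.
  symmetry; apply: eq_card0 => T; rewrite !inE; apply/negP => /andP[/is_rect_rppP].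
  move=> [m b s ct] /eqP hE; apply: nE.
  have := ct (size al) (leqnn _); rewrite rev_cons nth_rcons size_rev ltnn eqxx
    => <-.
  rewrite ndiff_count ?(ptleq_size (subcols_ptleq k'k))// sk -card_ord_count.
  apply: eq_card => j; rewrite !inE -hE; apply/idP/existsP => [jj|[i /eqP iE]].
    have ir : nth 0 (heights T (size al)) j < r.
      by apply: leq_trans jj _; apply: (allP kr); rewrite mem_nth// sk.
    exists (Ordinal ir); have := s (Ordinal ir, j);
      have := heightsP (size al) (Ordinal ir) j m.
    by rewrite /= ltnn jj; lia.
  have := s (i, j); have := heightsP (size al) i j m.
  by rewrite /= iE ltnn ltnS leqnn; lia.
rewrite -big_seq.
(* After exchanging the sums, each filling is counted once, at its own [heights]. *)
under eq_bigr do rewrite -sum1_card big_mkcond /=.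
rewrite exchange_big /= -sum1_card big_mkcond /=; apply: eq_bigr => T _.
rewrite !inE; case: ifP => TR; last by rewrite big1// => k' _; rewrite !inE TR.
have /is_rect_rppP[m b s ct] := TR.
under eq_bigr => k' _ do rewrite inE TR /= eq_sym.
rewrite -big_mkcond /= (big_uniq_pred1 (fun=> 1)) ?uniq_subcols//.
rewrite mem_subcols decr_heights//=; apply: ptleqP;
  first by rewrite size_heights sk.
move=> j; case: (ltnP j c) => [jc|cj]; last by rewrite nth_default ?size_heights.
rewrite -[j]/(val (Ordinal jc)) nth_heights.
have jr : nth 0 k j <= r by apply: (allP kr); rewrite mem_nth// sk.
rewrite -[X in _ <= X](card_ord_lt jr).
apply/subset_leq_card/fintype.subsetP => i; rewrite !inE => h.
by have := s (i, Ordinal jc); rewrite /= ltnS (ltnW h).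
Qed.

End RectFillings.

(** * Monomials up to permutation of the variables *)

Section Shapes.
Local Open Scope nat_scope.
Implicit Types (a b : monomial) (lam mu : int_part).

Lemma decr_part lam : decr lam.
Proof. by case: lam => s /= /andP[]. Qed.

Lemma part_pos lam : all (leq 1) lam.
Proof. by case: lam => s /= /andP[]. Qed.

Definition supp_le n a := forall k, n <= k -> a k = 0.

Lemma supp_le_ex a : exists n, supp_le n a.
Proof.
exists (\max_(i <- finsupp a) i.+1) => k nk; apply/eqP; rewrite -memNfinsupp.
apply/negP => ka; have := @leq_bigmax_seq nat (enum_fset (finsupp a)) xpredT (fun
  i => i.+1) k ka isT.
by move/leq_trans => /(_ _ nk); rewrite ltnn.
Qed.

Lemma supp_leW n m a : n <= m -> supp_le n a -> supp_le m a.
Proof. by move=> nm na k mk; apply: na; lia. Qed.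

Definition expo a : seq nat := [seq a i | i <- finsupp a].

Lemma expo_word n a : supp_le n a -> perm_eq [seq x <- mkseq a n | 0 < x] (expo a).
Proof.
move=> na; rewrite filter_map; apply: perm_map; apply: uniq_perm.
- exact/filter_uniq/iota_uniq.
- exact: fset_uniq.
move=> i; rewrite mem_filter mem_iota mem_finsupp /=.
rewrite lt0n andb_idr// => ai; rewrite ltnNge; apply: contra ai => /na ->//.
Qed.

Lemma sumn_filter0 s : sumn [seq x <- s | 0 < x] = sumn s.
Proof. by elim: s => //= -[|x] s IH /=; rewrite IH. Qed.

Lemma mdeg_word n a : supp_le n a -> mdeg a = sumn (mkseq a n).
Proof.
move=> na; rewrite -sumn_filter0 (perm_sumn (expo_word na)) mdegE sumnE.
by rewrite /expo big_map.
Qed.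

Fact content_subproof a : is_partition (sort geq (expo a)).
Proof.
apply/andP; split; first by apply: sort_sorted => x y; apply: leq_total.
rewrite all_sort; apply/allP => x /mapP[i + ->].
by rewrite mem_finsupp lt0n.
Qed.

Definition content a : int_part := IntPart (content_subproof a).

Lemma perm_content a : perm_eq (content a) (expo a).
Proof. by rewrite /= perm_sort. Qed.

Lemma mdeg_content a : mdeg a = sumn (content a).
Proof. by rewrite (perm_sumn (perm_content a)) mdegE sumnE /expo big_map. Qed.

Lemma perm_part lam mu : perm_eq lam mu -> lam = mu.
Proof.
move=> p; apply: val_inj; apply: (sorted_eq (leT := geq)) => //;
  try exact: decr_part.
- exact: (rev_trans leq_trans).
- by move=> x y /=; lia.
Qed.

Lemma content_word n a lam : supp_le n a ->
  perm_eq [seq x <- mkseq a n | 0 < x] lam -> content a = lam.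
Proof.
move=> na p; apply: perm_part; rewrite (perm_trans (perm_content a))// perm_sym.
by apply: perm_trans (expo_word na); rewrite perm_sym.
Qed.

Definition mon (s : seq nat) : monomial :=
  [cmonom nth 0 s i | i in [fset i | i in iota 0 (size s)]]%M.

Lemma monE s i : mon s i = nth 0 s i.
Proof.
rewrite cmE fsfunE in_fset /= mem_iota /=.
by case: ltnP => // si; rewrite nth_default.
Qed.

Lemma supp_mon s : supp_le (size s) (mon s).
Proof. by move=> k sk; rewrite monE nth_default. Qed.

Lemma word_mon s : mkseq (mon s) (size s) = s.
Proof.
by apply: (@eq_from_nth _ 0); rewrite size_mkseq// => i si;
  rewrite nth_mkseq// monE.
Qed.

Lemma content_mon lam : content (mon lam) = lam.
Proof.
apply: (content_word (@supp_mon lam)); rewrite word_mon (all_filterP _)//.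
exact: part_pos.
Qed.

(** Equal lengths and equally many nonzero entries leave equally many zeros. *)
Lemma perm_filter0 s t : size s = size t ->
  perm_eq [seq x <- s | 0 < x] [seq x <- t | 0 < x] -> perm_eq s t.
Proof.
move=> sz p.
rewrite -(permPl (permEl (perm_filterC (fun x => 0 < x) s))) perm_sym.
rewrite -(permPl (permEl (perm_filterC (fun x => 0 < x) t))) perm_sym.
apply: perm_cat => //.
have E u : [seq x <- u | predC (fun x => 0 < x) x] =
  nseq (size u - size [seq x <- u | 0 < x]) 0.
  have -> : size u - size [seq x <- u | 0 < x] =
    size [seq x <- u | predC (fun x => 0 < x) x].
    by rewrite !size_filter -(count_predC (fun x => 0 < x) u) addKn.
  by apply/all_pred1P/allP => x; rewrite mem_filter /= => /andP[]; lia.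
by rewrite !E (perm_size p) sz.
Qed.

Lemma content_perm_word n a b : supp_le n a -> supp_le n b ->
  content a = content b ->
  perm_eq (mkseq a n) (mkseq b n).
Proof.
move=> na nb ab; apply: perm_filter0; first by rewrite !size_mkseq.
rewrite (perm_trans (expo_word na))// perm_sym (perm_trans (expo_word nb))//.
by apply: perm_trans (perm_content a); rewrite ab perm_sym perm_content.
Qed.

Lemma content_bij s a b : bijective s -> (forall i,
  b i = a (s i)) -> content a = content b.
Proof.
move=> bs ab; apply: perm_part.
rewrite (perm_trans (perm_content a))// perm_sym (perm_trans (perm_content b))//.
have -> : expo b = [seq a i | i <- [seq s i | i <- finsupp b]].
  by rewrite -map_comp; apply: eq_map => i; rewrite /= ab.
apply: perm_map; apply: uniq_perm; rewrite ?fset_uniq//.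
  by rewrite map_inj_uniq ?fset_uniq//; apply: bij_inj.
case: bs => t st ts k; apply/mapP/idP => [[j jb ->]|ka].
  by move: jb; rewrite !mem_finsupp ab.
by exists (t k); rewrite ?ts// mem_finsupp ab ts -mem_finsupp.
Qed.

Lemma perm_bij n a b : supp_le n a -> supp_le n b ->
  perm_eq (mkseq a n) (mkseq b n) ->
  exists2 s : nat -> nat, bijective s & forall i, b i = a (s i).
Proof.
move=> na nb; rewrite perm_sym => /(perm_iotaP 0)[Is]; rewrite size_mkseq => pI E.
have sI : size Is = n by rewrite (perm_size pI) size_iota.
have uI : uniq Is by rewrite (perm_uniq pI) iota_uniq.
have mI i : (i \in Is) = (i < n) by rewrite (perm_mem pI) mem_iota.
(* A permutation of the first [n] indices, extended by the identity. *)
exists (fun i => if i < n then nth 0 Is i else i).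
  exists (fun i => if i < n then index i Is else i) => i.
    case: (ltnP i n) => [iN|nI]; last by rewrite ltnNge nI.
    by rewrite -mI mem_nth ?sI// index_uniq ?sI.
  case: (ltnP i n) => [iN|nI]; last by rewrite ltnNge nI.
  by rewrite -[X in _ < X]sI index_mem mI iN nth_index// mI.
move=> i; case: (ltnP i n) => [iN|nI]; last by rewrite na// nb.
have := congr1 (fun s => nth 0 s i) E.
rewrite nth_mkseq// (nth_map 0) ?sI// nth_mkseq// -mI mem_nth// sI//.
Qed.

End Shapes.

Section Symmetric.
Variable K : comPzRingType.

(** Supports are finite, so equal contents are related by a permutation of finitely many variables.
    Symmetry can thus be used as dependence on [content] alone. *)
Lemma symmetric_content (f : series K) a b : symmetric_series f ->
  content a = content b -> f a = f b.
Proof.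
have [n na] := supp_le_ex a; have [m mb] := supp_le_ex b.
have {}na := supp_leW (leq_maxl n m) na; have {}mb := supp_leW (leq_maxr n m) mb.
move=> fs ab; have [s bs E] := perm_bij na mb (content_perm_word na mb ab).
exact: fs bs E.
Qed.

Lemma content_symmetric (f : series K) : (forall a b,
  content a = content b -> f a = f b) -> symmetric_series f.
Proof. by move=> H s a b bs ab; apply: H; apply: content_bij bs ab. Qed.

End Symmetric.

(** * Fillings of a shape as fillings of a rectangle *)

Definition part_cols (lam : int_part) := cols (head 0%N lam) lam.

Section Fillings.
Variable lam : int_part.
Local Open Scope nat_scope.
Notation r := (size lam).
Notation c := (head 0 lam).
Notation k := (part_cols lam).

Lemma part_cols_lt i j : (i < nth 0 k j) = (j < nth 0 lam i).
Proof.
rewrite colsE ?decr_part// andb_idl// => /leq_trans; apply.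
exact/nth_le_head/decr_part.
Qed.

Lemma box_in (b : box lam part_empty) : row_of b < nth 0 k (col_of b).
Proof. by rewrite part_cols_lt; have /andP[] := valP b. Qed.

Lemma in_box (i : 'I_r) (j : 'I_c) : i < nth 0 k j ->
  exists b : box lam part_empty, row_of b = i /\ col_of b = j.
Proof.
rewrite part_cols_lt => ij.
have H : nth 0 part_empty i <= j < nth 0 lam i by rewrite nth_nil.
by exists (exist _ (i, j) H).
Qed.

Lemma box_inj (b b' : box lam part_empty) :
  row_of b = row_of b' -> col_of b = col_of b' -> b = b'.
Proof.
case: b b' => [[i j] h] [[i' j'] h'] /= rr cc; apply: val_inj => /=.
by move: rr cc; rewrite /row_of /col_of /= => -> ->.
Qed.

Lemma rpp_mono (T : filling lam part_empty) : is_rpp T -> forall b b',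
  row_of b <= row_of b' -> col_of b <= col_of b' -> T b <= T b'.
Proof.
move=> [hr hc] b b' rr cc.
have [d [dr dc]] : exists d : box lam part_empty,
  row_of d = row_of b /\ col_of d = col_of b'.
  by apply: in_box; apply: leq_ltn_trans rr (box_in b').
apply: (@leq_trans (T d)); [apply: hr|apply: hc]; rewrite ?dr ?dc//.
Qed.

Definition of_rect n (T : {ffun 'I_r * 'I_c -> 'I_n.+1}) : filling lam part_empty :=
  [ffun b => T (row_of b, col_of b) : nat].

Lemma num_cols_gt0 (T : filling lam part_empty) b : 0 < num_cols T (T b).
Proof.
apply/card_gt0P; exists (col_of b); rewrite inE; apply/existsP; exists b.
by rewrite !eqxx.
Qed.

(** A value of exponent zero cannot occur, so all entries are below [n] and the set is a finite
    list. The word is reversed because chains are read from the largest entry downwards. *)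
Lemma fillings_of_rect n (a : monomial) : supp_le n a ->
  [set T : filling lam part_empty | is_rpp T /\ forall x,
    num_cols T x = a x]%classic
  = [set` [seq of_rect T | T <- enum [pred T : {ffun 'I_r * 'I_c -> 'I_n.+1} |
                       is_rect_rpp k (rev (mkseq a n)) T]]]%classic.
Proof.
move=> na; apply/seteqP; split=> T /=.
  move=> [Trpp Ta]; have Tn b : T b < n.
    rewrite ltnNge; apply/negP => /na; rewrite -Ta => T0.
    by have := num_cols_gt0 T b; rewrite T0.
  pose g (p : 'I_r * 'I_c) := [pick b : box lam part_empty | (row_of b == p.1) &&
    (col_of b == p.2)].
  (* Outside of the shape [T'] takes the value [n] of [ord_max], the length of the word. *)
  pose T' := [ffun p => if g p is Some b then inord (T b) else ord_max] : {ffun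
    'I_r * 'I_c -> 'I_n.+1}.
  have T'in b : T' (row_of b, col_of b) = T b :> nat.
    rewrite ffunE /g; case: pickP => [b' /andP[/eqP rr /eqP cc]|/(_ b)];
      last by rewrite !eqxx.
    by rewrite (box_inj rr cc) inordK// (leq_trans (Tn _)).
  have T'out (p : 'I_r * 'I_c) : ~~ (p.1 < nth 0 k p.2) -> T' p = n :> nat.
    rewrite ffunE /g; case: pickP => [b' /andP[/eqP <- /eqP <-]|//].
    by rewrite box_in.
  have -> : T = of_rect T' by apply/ffunP => b; rewrite ffunE T'in.
  apply: map_f; rewrite mem_enum inE; apply/is_rect_rppP; split.
  - move=> p q h1 h2; have [qk|qk] := boolP (q.1 < nth 0 k q.2); last first.
      by rewrite (T'out q)// -ltnS ltn_ord.
    have pk : p.1 < nth 0 k p.2.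
      rewrite part_cols_lt; apply: leq_ltn_trans h2 _; rewrite -part_cols_lt.
      exact: leq_ltn_trans h1 qk.
    have [b [br bc]] := in_box pk; have [b' [br' bc']] := in_box qk.
    rewrite [p]surjective_pairing [q]surjective_pairing -br -bc -br' -bc' !T'in.
    by apply: rpp_mono; rewrite ?br ?bc ?br' ?bc'.
  - by move=> p; rewrite size_rev size_mkseq -ltnS.
  - move=> p; rewrite size_rev size_mkseq.
    have [pk|pk] := boolP (p.1 < nth 0 k p.2); last by rewrite T'out// ltnn.
    have [b [br bc]] := in_box pk.
    by rewrite [p]surjective_pairing -br -bc T'in Tn.
  - move=> x; rewrite size_rev size_mkseq revK => xn; rewrite nth_mkseq// -Ta.
    apply: eq_card => j; rewrite !inE; apply/existsP/existsP => [[i /eqP iE]|[b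
      /andP[/eqP <- /eqP <-]]].
      have [pk|pk] := boolP (i < nth 0 k j).
        have [b [br bc]] := in_box pk; exists b.
        by rewrite bc eqxx -iE -br -bc T'in eqxx.
      by move: iE; rewrite (T'out (i, j))// => nx; move: xn; rewrite nx ltnn.
    by exists (row_of b); rewrite T'in.
move=> /mapP[T']; rewrite mem_enum inE => /is_rect_rppP[m b s ct] ->.
rewrite !size_rev !size_mkseq in b s ct.
split.
  by split=> d e h1 h2; rewrite !ffunE; apply: m => //=; rewrite h1.
move=> x; case: (ltnP x n) => xn.
  have := ct x xn; rewrite revK nth_mkseq// => <-.
  apply: eq_card => j; rewrite !inE; apply/existsP/existsP => [[d /andP[/eqP
    <-]]|[i iE]].
    by rewrite ffunE => h; exists (row_of d).
  have [|d [dr dc]] := @in_box i j; first by rewrite -(s (i, j)) (eqP iE).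
  by exists d; rewrite dc eqxx ffunE dr dc.
rewrite na//; apply: eq_card0 => j; rewrite !inE; apply/existsP => -[d /andP[_]].
rewrite ffunE => /eqP dE; have := box_in d.
by have := s (row_of d, col_of d); rewrite dE /= => <-; rewrite ltnNge xn.
Qed.

(** Outside of the shape the value is forced to be [n]. *)
Lemma of_rect_inj n (al : seq nat) : size al = n ->
  {in [pred T : {ffun 'I_r * 'I_c -> 'I_n.+1} | is_rect_rpp k al T] &,
    injective (@of_rect n)}.
Proof.
move=> sz T T'; rewrite !inE => /is_rect_rppP[_ b s _] /is_rect_rppP[_ b' s' _] E.
rewrite sz in b s b' s'.
apply/ffunP => p; apply: val_inj => /=.
have [pk|pk] := boolP (p.1 < nth 0 k p.2).
  have [d [dr dc]] := in_box pk.
  have := congr1 (fun T : filling lam part_empty => T d) E.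
  by rewrite !ffunE dr dc -surjective_pairing.
by have := b p; have := b' p; have := s p; have := s' p; rewrite (negbTE pk); lia.
Qed.

End Fillings.

(** * Symmetry and degree of the [g_lambda] *)

Section GSeries.
Variable K : comPzRingType.
Implicit Types (lam mu : int_part) (a : monomial).

Lemma decr_part_cols lam : decr (part_cols lam).
Proof. exact: decr_cols. Qed.

(** The reversal of the word in [fillings_of_rect] is undone by [rpp_count_perm]. *)
Lemma g_series_word lam a n : supp_le n a ->
  g_skew_series K lam part_empty a = (rpp_count (part_cols lam) (mkseq a n))%:R.
Proof.
move=> na; rewrite /g_skew_series (fillings_of_rect lam na) -fsbig_seq; last first.
  rewrite map_inj_in_uniq ?enum_uniq// => T T'; rewrite !mem_enum => h h'.
  by apply: (of_rect_inj _ h h'); rewrite size_rev size_mkseq.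
rewrite big_map big_const_seq count_predT -cardE card_rect.
- by rewrite iter_addr_0 (rpp_count_perm (s2 := mkseq a n)) ?decr_part_cols//
  perm_rev.
- exact: decr_part_cols.
- exact: size_cols.
- by apply/allP => x /mapP[j _ ->] /=; apply: count_size.
- by rewrite size_rev size_mkseq.
Qed.

Lemma rpp_count_content lam a n : supp_le n a ->
  rpp_count (part_cols lam) (mkseq a n) = rpp_count (part_cols lam) (content a).
Proof.
move=> na; rewrite -rpp_count_filter0 ?decr_part_cols//;
  apply: rpp_count_perm (decr_part_cols _) _.
by rewrite (perm_trans (expo_word na))// perm_sym perm_content.
Qed.

Lemma g_seriesE lam a :
  g_skew_series K lam part_empty a = (rpp_count (part_cols lam) (content a))%:R.
Proof. by have [n na] := supp_le_ex a; rewrite (g_series_word _ na)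
  rpp_count_content. Qed.

Lemma sumn_part_cols lam : sumn (part_cols lam) = sumn lam.
Proof.
rewrite sumn_cols//; apply/(all_nthP 0%N) => i _ /=.
exact/nth_le_head/decr_part.
Qed.

Fact g_in_Lambda lam : g_skew_series K lam part_empty \in @in_Lambda K.
Proof.
apply/asboolP; split; first by apply: content_symmetric => a b ab;
  rewrite !g_seriesE ab.
exists (sumn lam) => a la; rewrite g_seriesE.
have := @rpp_count_sumn (part_cols lam) (content a);
  rewrite sumn_part_cols -mdeg_content.
by case: (rpp_count _ _) => // n /(_ isT); lia.
Qed.

Lemma gpolyE lam a : gpoly K lam a = (rpp_count (part_cols lam) (content a))%:R.
Proof. by rewrite /gpoly -g_seriesE -[in RHS](insubdK (0 : Lambda K) (g_in_Lambda
  lam)). Qed.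

Lemma card_box lam : #|{: box lam part_empty}| = sumn lam.
Proof.
rewrite card_sig (eq_card (B := [pred p : 'I_(size lam) * 'I_(head 0%N lam) |
  (p.2 < nth 0 lam p.1)%N])).
  rewrite -sum1_card big_mkcond /=.
  rewrite -(pair_bigA _ (fun (i : 'I_(size lam)) (j : 'I_(head 0 lam)) => if j <
    nth 0 lam i then 1 else 0)%N) /=.
  rewrite sumnE (big_nth 0%N) big_mkord; apply: eq_bigr => i _.
  rewrite -big_mkcond /= sum1_card -[RHS](@card_ord_lt (head 0%N lam)).
    by apply: eq_card => j; rewrite !inE.
  exact/nth_le_head/decr_part.
by move=> p; rewrite !inE /= nth_nil.
Qed.

End GSeries.

(** * Schur functions and the Hall pairing *)

Section SchurFillings.
Local Open Scope nat_scope.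
Variable lam : int_part.
Implicit Types (T : filling lam part_empty) (a : monomial).

Lemma num_colsE T x :
  num_cols T x = #|(@col_of lam part_empty @: [set b : box lam part_empty | T b
    == x])%SET|.
Proof.
apply: eq_card => j; rewrite !inE; apply/existsP/imsetP => [[b /andP[/eqP<-
  bx]]|[b]].
  by exists b => //; rewrite inE.
by rewrite inE => bx ->; exists b; rewrite eqxx.
Qed.

Lemma num_cols_le T x : num_cols T x <= num_boxes T x.
Proof. by rewrite num_colsE leq_imset_card. Qed.

Lemma sum_num_boxes T n : (forall b, T b < n) ->
  \sum_(x < n) num_boxes T x = sumn lam.
Proof.
move=> Tn; rewrite -card_box -[RHS]sum1_card.
rewrite (eq_bigr (fun x : 'I_n => \sum_(b : box lam part_empty) if T b == x then
  1 else 0)).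
  2: by move=> x _; rewrite -big_mkcond sum1dep_card.
rewrite exchange_big /=; apply: eq_bigr => b _.
rewrite (bigD1 (Ordinal (Tn b))) //= eqxx big1// => x xb.
by case: eqP => // bx; case/eqP: xb; apply: val_inj; rewrite /= bx.
Qed.

Lemma mdeg_sum n a : supp_le n a -> mdeg a = \sum_(x < n) a x.
Proof.
by move=> na; rewrite (mdeg_word na) sumnE big_map -[n in iota 0 n]subn0 big_mkord.
Qed.

(* A column of a reverse plane partition is strict as soon as each entry fills
   a single box of it, and the degree forces this. *)
Lemma ssyt_rpp T a :
  (is_ssyt T /\ forall x, num_boxes T x = a x) <->
  [/\ is_rpp T, forall x, num_cols T x = a x & mdeg a = sumn lam].
Proof.
have [n na] := supp_le_ex a.
split=> [[[Tr Tc] Ta]|[[Tr Tc] Ta dg]].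
  have Tn b : T b < n.
    rewrite ltnNge; apply/negP => /na; rewrite -Ta => /eqP.
    by rewrite cards_eq0 => /eqP/setP/(_ b); rewrite !inE eqxx.
  split.
  - split=> // b c bc; rewrite leq_eqVlt => /orP[/eqP rr|/(Tc b c bc)/ltnW//].
    by rewrite (box_inj (val_inj rr) bc).
  - move=> x; rewrite num_colsE -Ta; apply: card_in_imset => b c; rewrite !inE.
    move=> /eqP bx /eqP cx bc; apply: box_inj => //; apply/val_inj.
    case: (ltngtP (row_of b) (row_of c)) => // rr.
      by have := Tc b c bc rr; rewrite bx cx ltnn.
    by have := Tc c b (esym bc) rr; rewrite bx cx ltnn.
  - by rewrite (mdeg_sum na) -(sum_num_boxes Tn); apply: eq_bigr => x _.
have Tn b : T b < n.
  rewrite ltnNge; apply/negP => /na; rewrite -Ta => T0.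
  by have := num_cols_gt0 T b; rewrite T0.
have E x : num_cols T x = num_boxes T x.
  case: (ltnP x n) => [xn|nx]; last first.
    rewrite Ta na//; apply/esym/eqP; rewrite cards_eq0; apply/eqP/setP => b;
      rewrite !inE.
    by have := Tn b; lia.
  (* The termwise inequality [num_cols_le] has equal sums on both sides, namely the degree, so all
     terms agree. *)
  have := @leqif_sum 'I_n xpredT (fun x => num_cols T x == num_boxes T x)
    (fun x : 'I_n => num_cols T x) (fun x : 'I_n => num_boxes T x) _.
  case=> [y _|_]; first by split=> //; apply: num_cols_le.
  rewrite sum_num_boxes// -dg (mdeg_sum na) (eq_bigr _ (fun (x : 'I_n) _ => Ta
    x)) eqxx.
  by move/esym/forallP/(_ (Ordinal xn))/eqP.
split; last by move=> x; rewrite -E.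
split=> // b c bc rr; rewrite ltn_neqAle Tc ?andbT// 1?ltnW//;
  apply/negP => /eqP TT.
have /imset_injP/(_ b c) : #|(@col_of lam part_empty @: [set d : box lam
  part_empty | T d == T b])%SET|
   == #|[set d : box lam part_empty | T d == T b]%SET| by rewrite -num_colsE E.
rewrite !inE eqxx TT eqxx => /(_ isT isT bc) bc'.
by move: rr; rewrite bc' ltnn.
Qed.

End SchurFillings.

(** * Finite lists of partitions *)

Section PartitionLists.
Local Open Scope nat_scope.
Implicit Types (lam mu : int_part) (k : seq nat).

Definition part_of_cols k : int_part := insubd part_empty (cols (head 0 k) k).

Lemma part_of_colsE k : decr k -> part_of_cols k = cols (head 0 k) k :> seq nat.
Proof.
move=> d; rewrite [LHS]val_insubd /= (_ : is_partition _ = true)//.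
apply/andP; split; first exact: decr_cols.
apply/(all_nthP 0) => j; rewrite size_cols => jh.
by rewrite nth_cols// count_decr// nth0.
Qed.

Lemma part_of_colsK k : decr k -> cols (size k) (part_of_cols k) = k.
Proof. by move=> d; rewrite part_of_colsE// colsK. Qed.

Lemma part_of_cols_lt k i j : decr k -> (j < nth 0 (part_of_cols k) i) =
  (i < nth 0 k j).
Proof.
move=> d; rewrite part_of_colsE// colsE// andb_idl// => /leq_trans; apply.
exact: nth_le_head.
Qed.

Lemma rpp_count_part_of_cols k al : decr k -> rpp_count (part_cols (part_of_cols
  k)) al = rpp_count k al.
Proof.
move=> d; rewrite -[in RHS](part_of_colsK d).
have h : head 0 (part_of_cols k) <= size k.
  rewrite leqNgt -nth0; apply/negP; rewrite part_of_cols_lt// => H.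
  by move: H; rewrite nth_default.
rewrite -(subnKC h) cols_cat0 ?rpp_count_cat0//.
apply/(all_nthP 0) => i _ /=; exact/nth_le_head/decr_part.
Qed.

Lemma sumn_part_of_cols k : decr k -> sumn (part_of_cols k) = sumn k.
Proof.
move=> d; rewrite part_of_colsE// sumn_cols//; apply/(all_nthP 0) => i _ /=.
exact: nth_le_head.
Qed.

Lemma colsK_part c lam : head 0 lam <= c -> part_of_cols (cols c lam) = lam.
Proof.
move=> hc; apply: val_inj; rewrite /= part_of_colsE ?decr_cols//.
rewrite -[RHS](colsK (decr_part lam) hc); congr cols.
case: c hc => [|c] hc.
  have := part_pos lam; case: (parts lam) hc => //= x s; rewrite leqn0 => /eqP->//.
by rewrite /=; apply/eqP; rewrite -all_count part_pos.
Qed.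

Definition subparts lam := [seq part_of_cols k | k <- subcols (part_cols lam)].

Lemma mem_subparts lam mu : (mu \in subparts lam) <-> part_sub mu lam.
Proof.
split=> [/mapP[k kl ->] i|ml].
  have d := subcols_decr kl; rewrite leqNgt; apply/negP;
    rewrite part_of_cols_lt// => h.
  have := leq_trans h (ptleq_nth _ (subcols_ptleq kl)).
  by rewrite part_cols_lt ltnn.
have hm : head 0 mu <= head 0 lam by have := ml 0; rewrite !nth0.
apply/mapP; exists (cols (head 0 lam) mu); last by rewrite colsK_part.
rewrite mem_subcols decr_cols; apply: ptleqP => [|j]; first by rewrite !size_cols.
rewrite leqNgt; apply/negP => h.
have := h; rewrite colsE ?decr_part// => /andP[jc]; rewrite ltnNge => /negP; apply.
rewrite leqNgt; apply/negP => /leq_trans/(_ (ml _)).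
by rewrite -part_cols_lt ltnn.
Qed.

Lemma uniq_subparts lam : uniq (subparts lam).
Proof.
rewrite map_inj_in_uniq ?uniq_subcols// => k k' kl kl' E.
rewrite -(part_of_colsK (subcols_decr kl)) -(part_of_colsK (subcols_decr kl')) E.
by rewrite (ptleq_size (subcols_ptleq kl)) (ptleq_size (subcols_ptleq kl')).
Qed.

Lemma set_subparts lam : [set mu | part_sub mu lam]%classic =
  [set` subparts lam]%classic.
Proof. by apply/seteqP; split=> mu /= /mem_subparts. Qed.

Fact square_subproof d : is_partition (nseq d d).
Proof.
apply/andP; split; last by rewrite all_nseq lt0n; case: d.
by case: {1}d => //= n; elim: n => //= n ->; rewrite leqnn.
Qed.

(** It contains every partition of size at most [d], so that these form a finite list. *)
Definition square d : int_part := IntPart (square_subproof d).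

Lemma part_size lam : size lam <= sumn lam.
Proof.
have := part_pos lam; elim: (parts lam) => //= x s IH /andP[x0 /IH]; lia.
Qed.

Lemma sub_square lam d : sumn lam <= d -> part_sub lam (square d).
Proof.
move=> ld i; rewrite nth_nseq; case: ltnP => [_|di].
  apply: leq_trans ld; case: (ltnP i (size lam)) => [il|li];
    last by rewrite nth_default.
  by elim: (parts lam) i il => //= x s IH [|i];
    rewrite ?leq_addr// ltnS => /IH/=; lia.
by rewrite nth_default//; have := part_size lam; lia.
Qed.

Definition parts_of d := [seq mu : int_part <- subparts (square d) | sumn mu == d].
Definition parts_le d := [seq mu : int_part <- subparts (square d) | sumn mu <= d].

Lemma mem_parts_of d mu : (mu \in parts_of d) = (sumn mu == d).
Proof.
rewrite mem_filter andb_idr// => /eqP md; apply/mem_subparts/sub_square.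
by rewrite md.
Qed.

Lemma mem_parts_le d mu : (mu \in parts_le d) = (sumn mu <= d).
Proof. by rewrite mem_filter andb_idr// => md; apply/mem_subparts/sub_square. Qed.

Lemma uniq_parts_of d : uniq (parts_of d).
Proof. exact/filter_uniq/uniq_subparts. Qed.

Lemma uniq_parts_le d : uniq (parts_le d).
Proof. exact/filter_uniq/uniq_subparts. Qed.

End PartitionLists.

Lemma big_parts_le (V : nmodType) d m (F : int_part -> V) :
  (forall lam : int_part, sumn lam != m -> F lam = 0) ->
  \sum_(lam <- parts_le d) F lam =
  if (m <= d)%N then \sum_(lam <- parts_of m) F lam else 0.
Proof.
move=> F0; case: leqP => md; last first.
  rewrite big_seq big1// => lam; rewrite mem_parts_le => ld; apply: F0; lia.
rewrite (bigID (fun lam : int_part => sumn lam == m)) /= [X in _ + X]big1// addr0.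
rewrite -big_filter; apply: perm_big; apply: uniq_perm.
- exact/filter_uniq/uniq_parts_le.
- exact: uniq_parts_of.
- by move=> mu; rewrite mem_filter mem_parts_le mem_parts_of andb_idr// => /eqP->.
Qed.

(** * Unitriangular systems *)

Section Unitriangular.
Variables (K : comPzRingType) (X : eqType) (k : X -> X -> K).

(** Forward substitution: the later elements do not affect the value at the head [x], so the
    coefficient of [x] is [f x]; what is left after subtracting its contribution is solved on the
    tail. *)
Lemma unitri_exists (s : seq X) (f : X -> K) : uniq s -> (forall x, k x x = 1) ->
  pairwise (fun x y => k y x == 0) s ->
  exists c, forall x, x \in s -> f x = \sum_(y <- s) c y * k y x.
Proof.
move=> + k1; elim: s f => [|x s IH] f; first by exists (fun=> 0).
move=> /= /andP[xs us] /andP[/allP kx ks].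
have [c cE] := IH (fun y => f y - f x * k x y) us ks.
exists (fun y => if y == x then f x else c y) => z; rewrite in_cons => zs.
rewrite big_cons eqxx.
rewrite (eq_big_seq (fun y => c y * k y z)); last first.
  by move=> y ys; case: eqP => // yx; move: xs; rewrite -yx ys.
case/orP: zs => [/eqP->|zs]; last by rewrite -cE// addrC subrK.
by rewrite k1 mulr1 big_seq big1 ?addr0// => y /kx/eqP->; rewrite mulr0.
Qed.

Lemma unitri_unique (s : seq X) (c : X -> K) : uniq s -> (forall x, k x x = 1) ->
  pairwise (fun x y => k y x == 0) s ->
  (forall x, x \in s -> \sum_(y <- s) c y * k y x = 0) ->
  forall x, x \in s -> c x = 0.
Proof.
move=> + k1; elim: s => [|x s IH] // /andP[xs us] /= /andP[/allP kx ks] H.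
have cx : c x = 0.
  have := H x (mem_head _ _); rewrite big_cons k1 mulr1 big_seq big1 ?addr0// =>
    y /kx/eqP->.
  by rewrite mulr0.
move=> z; rewrite in_cons => /orP[/eqP->//|zs]; apply: IH => // y ys.
by rewrite -[RHS](H y) ?in_cons ?ys ?orbT// big_cons cx mul0r add0r.
Qed.

End Unitriangular.

(** * The Schur basis *)

Section SchurBasis.
Variable K : comPzRingType.
Implicit Types (lam mu : int_part) (a : monomial) (F : Lambdahat K) (f : Lambda K).

(** A Kostka number when [al] has the size of [lam]; in general a coefficient of [g_lambda]. *)
Definition kostka lam (al : seq nat) : K := (rpp_count (part_cols lam) al)%:R.

(** By [ssyt_rpp], [s_lambda] is the part of top degree of [g_lambda]. *)
Lemma schur_seriesE lam a :
  schur_series K lam a = if mdeg a == sumn lam then kostka lam (content a) else 0.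
Proof.
rewrite /kostka -g_seriesE; case: eqP => dg.
  apply: eq_fsbigl; apply/seteqP; split=> T /=; first by move=> /ssyt_rpp[].
  by move=> [h1 h2]; apply/ssyt_rpp.
by rewrite /schur_series fsbig1// => T /ssyt_rpp[].
Qed.

Lemma schur_sum (c : int_part -> K) a :
  \sum_(lam \in [set: int_part]) c lam * schur_series K lam a =
  \sum_(lam <- parts_of (mdeg a)) c lam * kostka lam (content a).
Proof.
rewrite (@fsbigE _ _ _ _ _ (parts_of (mdeg a))).
- rewrite big_seq_cond [RHS]big_seq; apply: eq_big => [lam|lam /andP[]].
    by rewrite in_setT andbT.
  by rewrite mem_parts_of schur_seriesE => /eqP->; rewrite eqxx.
- exact: uniq_parts_of.
- by [].
- move=> lam _; rewrite mem_parts_of schur_seriesE eq_sym => /negbTE->.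
  by rewrite mulr0.
Qed.

Lemma kostka_diag lam : kostka lam lam = 1.
Proof.
rewrite /kostka rpp_count_diag ?decr_part//; apply/(all_nthP 0%N) => i _ /=.
exact/nth_le_head/decr_part.
Qed.

Lemma kostka_lex lam mu : sumn lam = sumn mu -> lam <> mu -> lexleq lam mu ->
  kostka lam mu = 0.
Proof.
move=> E lm le; rewrite /kostka; case: (eqVneq (rpp_count (part_cols lam) mu)
  0%N) => [->//|n0].
have H := @rpp_count_lex (head 0%N lam) lam mu (decr_part lam) _ (part_pos mu) E n0.
case: lm; apply: val_inj; apply: lexleq_anti; rewrite le H//.
by apply/(all_nthP 0%N) => i _ /=; exact/nth_le_head/decr_part.
Qed.

(** Lexicographically decreasing, the order in which the Kostka matrix is unitriangular. *)
Definition lex_parts d := sort (fun lam mu : int_part => lexleq mu lam) (parts_of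
  d).

Lemma mem_lex_parts d mu : (mu \in lex_parts d) = (sumn mu == d).
Proof. by rewrite mem_sort mem_parts_of. Qed.

Lemma uniq_lex_parts d : uniq (lex_parts d).
Proof. by rewrite sort_uniq uniq_parts_of. Qed.

Lemma kostka_unitri d : pairwise (fun lam mu => kostka mu lam == 0) (lex_parts d).
Proof.
have tr : transitive (fun lam mu : int_part => lexleq mu lam).
  by move=> y x z xy yz; apply: lexleq_trans yz xy.
have tot : total (fun lam mu : int_part => lexleq mu lam) by move=> x y;
  apply: lexleq_total.
have p1 : pairwise (fun lam mu : int_part => lexleq mu lam) (lex_parts d).
  by rewrite -sorted_pairwise//; apply: sort_sorted.
have p2 : pairwise (fun lam mu : int_part => lam != mu) (lex_parts d).
  by rewrite -uniq_pairwise uniq_lex_parts.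
have : pairwise (fun lam mu : int_part => lexleq mu lam &&
  (lam != mu)) (lex_parts d).
  by rewrite pairwise_relI p1 p2.
apply: (@sub_in_pairwise _ (fun mu : int_part => sumn mu == d)); last first.
  by apply/allP => mu; rewrite mem_lex_parts.
move=> lam mu; rewrite !unfold_in => /eqP dl /eqP dm /andP[le ne].
by apply/eqP/kostka_lex => //; [rewrite dl dm | apply/eqP; rewrite eq_sym].
Qed.

Lemma big_lex_parts d (h : int_part -> K) :
  \sum_(lam <- parts_of d) h lam = \sum_(lam <- lex_parts d) h lam.
Proof. by apply: perm_big; rewrite perm_sym perm_sort. Qed.

Lemma Lambdahat_sym F a b : content a = content b -> F a = F b.
Proof. by apply: symmetric_content; have /asboolP := LambdahatP F. Qed.

(** The coefficients are solved for degree by degree, at one monomial for each partition. *)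
Lemma schur_exists F : exists c : int_part -> K, forall a,
  F a = \sum_(lam <- parts_of (mdeg a)) c lam * kostka lam (content a).
Proof.
have /choice[c cE] : forall d, exists c, forall mu, mu \in lex_parts d ->
    F (mon mu) = \sum_(lam <- lex_parts d) c lam * kostka lam mu.
  move=> d; apply: unitri_exists; first exact: uniq_lex_parts.
    exact: kostka_diag.
  exact: kostka_unitri.
exists (fun lam : int_part => c (sumn lam) lam) => a.
rewrite (@Lambdahat_sym F a (mon (content a))) ?content_mon//.
rewrite (cE (mdeg a)) ?mem_lex_parts -?mdeg_content// -big_lex_parts.
by apply: eq_big_seq => lam; rewrite mem_parts_of => /eqP->.
Qed.

Lemma schur_unique (c : int_part -> K) :
  (forall a, \sum_(lam <- parts_of (mdeg a)) c lam * kostka lam (content a) = 0) ->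
  c =1 fun=> 0.
Proof.
move=> H lam; apply: (unitri_unique (uniq_lex_parts (sumn lam)) kostka_diag
  (kostka_unitri _)).
  move=> mu; rewrite mem_lex_parts => /eqP dm;
    rewrite -big_lex_parts -[RHS](H (mon mu)).
  by rewrite mdeg_content content_mon dm.
by rewrite mem_lex_parts.
Qed.

(** An expansion exists, so the default value in [schur_coef] is not taken. *)
Lemma schur_coefE F a :
  F a = \sum_(lam <- parts_of (mdeg a)) schur_coef F lam * kostka lam (content a).
Proof.
rewrite -schur_sum /schur_coef; case: xgetP => [c _ /= ->//|H].
have [c cE] := schur_exists F.
by case: (H c) => b /=; rewrite schur_sum.
Qed.

Lemma schur_coefP F c :
  (forall a, F a = \sum_(lam <- parts_of (mdeg a)) c lam * kostka lam (content
    a)) ->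
  schur_coef F =1 c.
Proof.
move=> H lam; apply/eqP; rewrite -subr_eq0.
rewrite (@schur_unique (fun lam => schur_coef F lam - c lam))//.
move=> a; under eq_bigr do rewrite mulrBl.
by rewrite sumrB -H -schur_coefE subrr.
Qed.

Lemma schur_coef_lin (u : K) F F' lam :
  schur_coef (u *: F + F') lam = u * schur_coef F lam + schur_coef F' lam.
Proof.
apply: (schur_coefP (c := fun lam => u * schur_coef F lam + schur_coef F' lam))
  => a.
under eq_bigr do rewrite mulrDl -mulrA.
by rewrite big_split /= -mulr_sumr -!schur_coefE.
Qed.

Definition deg_le d (f : series K) := forall a, (d < mdeg a)%N -> f a = 0.

Lemma deg_le_ex f : exists d, deg_le d f.
Proof. by have /asboolP[] := LambdaP f. Qed.

Lemma deg_leW d d' (f : series K) : (d <= d')%N -> deg_le d f -> deg_le d' f.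
Proof. by move=> dd' fd a da; apply: fd; apply: leq_ltn_trans da. Qed.

(** Dropping the coefficients above degree [d] leaves another expansion of [F], so by uniqueness
    they vanish. *)
Lemma schur_coef_deg F d lam : deg_le d F -> (d < sumn lam)%N ->
  schur_coef F lam = 0.
Proof.
move=> Fd dl.
have -> := @schur_coefP F (fun lam : int_part => if (sumn lam <= d)%N then
  schur_coef F lam else 0).
  by rewrite leqNgt dl.
move=> a; rewrite [LHS]schur_coefE; case: (leqP (mdeg a) d) => ad.
  by apply: eq_big_seq => mu; rewrite mem_parts_of => /eqP->; rewrite ad.
rewrite -schur_coefE Fd// big_seq big1// => mu; rewrite mem_parts_of => /eqP->.
by rewrite leqNgt ad mul0r.
Qed.

Fact schur_in_Lambda lam : schur_series K lam \in @in_Lambda K.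
Proof.
apply/asboolP; split; first by apply: content_symmetric => a b ab;
  rewrite !schur_seriesE !mdeg_content ab.
by exists (sumn lam) => a la; rewrite schur_seriesE (gtn_eqF la).
Qed.

Definition schur lam : Lambda K := MkLambda (schur_in_Lambda lam).

Lemma schur_coef_schur lam mu : schur_coef (hat (schur lam)) mu = (mu == lam)%:R.
Proof.
apply: (schur_coefP (c := fun mu => (mu == lam)%:R)) => a.
rewrite [LHS]schur_seriesE; case: eqP => dg.
  rewrite (bigD1_seq lam) ?uniq_parts_of ?mem_parts_of ?dg//= eqxx mul1r big1
    ?addr0//.
  by move=> nu /negbTE->; rewrite mul0r.
rewrite big_seq big1// => nu; rewrite mem_parts_of => /eqP dn.
by case: eqP => [nl|]; rewrite ?mul0r//; case: dg; rewrite -dn nl.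
Qed.

Lemma Lambda_eq f f' : (forall a, f a = f' a) -> f = f'.
Proof. by move=> E; apply: val_inj; apply/funext. Qed.

Lemma Lambda_linE (u : K) f f' a : (u *: f + f') a = u * f a + f' a.
Proof. by []. Qed.

Lemma Lambda_sumE (I : Type) (s : seq I) (P : pred I) (G : I -> Lambda K) a :
  (\sum_(i <- s | P i) G i) a = \sum_(i <- s | P i) G i a.
Proof. exact: (big_morph (fun f : Lambda K => f a)). Qed.

Lemma schur_expand f d : deg_le d f ->
  f = \sum_(lam <- parts_le d) schur_coef (hat f) lam *: schur lam.
Proof.
move=> fd; apply: Lambda_eq => a; rewrite Lambda_sumE.
rewrite (big_parts_le _ (m := mdeg a)) => [|lam la].
  case: leqP => ad; last by rewrite fd.
  rewrite -[LHS]/(hat f a) schur_coefE; apply: eq_big_seq => lam.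
  rewrite mem_parts_of => /eqP la; rewrite -[RHS]/(_ * schur_series K lam a).
  by rewrite schur_seriesE la eqxx.
rewrite -[LHS]/(_ * schur_series K lam a) schur_seriesE eq_sym (negbTE la).
by rewrite mulr0.
Qed.

Lemma hallE F f d : deg_le d f ->
  hall F f = \sum_(lam <- parts_le d) schur_coef F lam * schur_coef (hat f) lam.
Proof.
move=> fd; rewrite /hall (@fsbigE _ _ _ _ _ (parts_le d)) ?uniq_parts_le//.
  by apply: eq_bigl => lam; rewrite in_setT.
move=> lam _; rewrite mem_parts_le -ltnNge => dl.
by rewrite (@schur_coef_deg (hat f) d)// mulr0.
Qed.

Lemma hall_lin F (u : K) f f' : hall F (u *: f + f') = u * hall F f + hall F f'.
Proof.
have [d fd] := deg_le_ex f; have [d' fd'] := deg_le_ex f'.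
have {}fd := deg_leW (leq_maxl d d') fd; have {}fd' := deg_leW (leq_maxr d d') fd'.
rewrite (hallE _ fd) (hallE _ fd') (@hallE _ _ (maxn d d')); last first.
  by move=> a da; rewrite Lambda_linE fd// fd'// mulr0 addr0.
rewrite mulr_sumr -big_split /=; apply: eq_bigr => lam _.
have -> : hat (u *: f + f') = u *: hat f + hat f' by apply: val_inj.
by rewrite schur_coef_lin; ring.
Qed.

Lemma hall0 F : hall F 0 = 0.
Proof. by have := hall_lin F (-1) 0 0; rewrite scaler0 addr0 mulN1r addNr. Qed.

Lemma hallZ F (u : K) f : hall F (u *: f) = u * hall F f.
Proof. by rewrite -[u *: f]addr0 hall_lin hall0 addr0. Qed.

Lemma hall_sum F (I : Type) (s : seq I) (P : pred I) (G : I -> Lambda K) :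
  hall F (\sum_(i <- s | P i) G i) = \sum_(i <- s | P i) hall F (G i).
Proof.
apply: (big_morph (hall F)); last exact: hall0.
by move=> f f'; rewrite -[f]scale1r hall_lin mul1r scale1r.
Qed.

Lemma hall_schur F lam : hall F (schur lam) = schur_coef F lam.
Proof.
rewrite (@hallE _ _ (sumn lam)); last first.
  by move=> a la; rewrite [LHS]schur_seriesE (gtn_eqF la).
rewrite (bigD1_seq lam) ?uniq_parts_le ?mem_parts_le//= schur_coef_schur eqxx mulr1.
by rewrite big1 ?addr0// => mu /negbTE ml; rewrite schur_coef_schur ml mulr0.
Qed.

Lemma hall_linl (u : K) F F' f : hall (u *: F + F') f = u * hall F f + hall F' f.
Proof.
have [d fd] := deg_le_ex f; rewrite !(hallE _ fd) mulr_sumr -big_split /=.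
by apply: eq_bigr => lam _; rewrite schur_coef_lin; ring.
Qed.

Lemma Lambdahat_eq F F' : (forall lam, schur_coef F lam = schur_coef F' lam) ->
  F = F'.
Proof.
move=> E; apply: val_inj; apply/funext => a.
by rewrite [LHS]schur_coefE [RHS]schur_coefE; apply: eq_bigr => lam _; rewrite E.
Qed.

End SchurBasis.

(** * Specialization of a variable at 1 *)

Section Monomials.
Local Open Scope nat_scope.
Implicit Types (a b : monomial).

Definition ins x a : monomial :=
  [cmonom (if i is j.+1 then a j else x) |
     i in (0 |` [fset j.+1 | j in finsupp a])%fset]%M.

Lemma insE x a i : ins x a i = if i is j.+1 then a j else x.
Proof.
rewrite cmE fsfunE !inE; case: i => [|j] //=.
case: imfsetP => // H; case: finsuppP => // ja; case: H; by exists j.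
Qed.

Lemma interE a b i : interleave a b i = if odd i then b i./2 else a i./2.
Proof.
rewrite cmE fsfunE; case: ifP => // /negbT; rewrite in_fsetU negb_or =>
  /andP[/imfsetP h1 /imfsetP h2].
case: ifP => oi; case: finsuppP => // h.
  by case: h2; exists i./2 => //=; rewrite -[LHS]odd_double_half oi.
by case: h1; exists i./2 => //=; rewrite -[LHS]odd_double_half oi.
Qed.

Lemma content_expo a b : perm_eq (expo a) (expo b) -> content a = content b.
Proof.
move=> p; apply: perm_part; rewrite (perm_trans (perm_content a))// (perm_trans
  p)// perm_sym.
exact: perm_content.
Qed.

Lemma perm_expo a b : content a = content b -> perm_eq (expo a) (expo b).
Proof. by move=> ab; rewrite perm_sym -(permPl (perm_content b)) -ab
  perm_content. Qed.

Lemma word_ins x a n : mkseq (ins x a) n.+1 = x :: mkseq a n.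
Proof.
rewrite /mkseq /= insE; congr (_ :: _); rewrite (iotaDl 1) -map_comp.
by apply: eq_map => i; rewrite /= insE.
Qed.

Lemma supp_ins x a n : supp_le n a -> supp_le n.+1 (ins x a).
Proof. by move=> na [|i] //; rewrite insE => /na. Qed.

Lemma expo_ins x a : perm_eq (expo (ins x a)) ([seq y <- [:: x] | 0 < y] ++ expo a).
Proof.
have [n na] := supp_le_ex a.
rewrite -(permPl (expo_word (supp_ins x na))) word_ins -cat1s filter_cat perm_cat2l.
exact: expo_word.
Qed.

Lemma expo_inter a b : perm_eq (expo (interleave a b)) (expo a ++ expo b).
Proof.
have -> : expo a ++ expo b = [seq interleave a b i |
    i <- [seq i.*2 | i <- finsupp a] ++ [seq i.*2.+1 | i <- finsupp b]].
  rewrite map_cat -!map_comp; congr (_ ++ _); apply: eq_map => i /=;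
    by rewrite interE /= ?odd_double ?doubleK ?uphalf_double.
apply: perm_map; apply: uniq_perm; first exact: fset_uniq.
  rewrite cat_uniq !map_inj_uniq ?fset_uniq//=; last first.
  - exact: double_inj.
  - by move=> i j [/double_inj].
  rewrite andbT; apply/hasPn => _ /mapP[i _ ->]; apply/mapP => -[j _ /(congr1 odd)].
  by rewrite /= !odd_double.
move=> i; rewrite mem_cat mem_finsupp interE; apply/idP/orP => [|[]/mapP[j + ->]].
- case: ifP => oi h; [right|left]; apply/mapP; exists i./2; rewrite ?mem_finsupp//.
    by rewrite -[LHS]odd_double_half oi.
  by rewrite -[LHS]odd_double_half oi.
- by rewrite odd_double doubleK mem_finsupp.
- by rewrite /= odd_double /= uphalf_double mem_finsupp.
Qed.

Lemma mdeg_expo a : mdeg a = sumn (expo a).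
Proof. by rewrite mdeg_content (perm_sumn (perm_content a)). Qed.

Lemma mdeg_ins x a : mdeg (ins x a) = x + mdeg a.
Proof. by rewrite mdeg_expo (perm_sumn (expo_ins x a)) sumn_cat sumn_filter0
  mdeg_expo /= addn0. Qed.

Lemma mdeg_inter a b : mdeg (interleave a b) = mdeg a + mdeg b.
Proof. by rewrite mdeg_expo (perm_sumn (expo_inter a b)) sumn_cat !mdeg_expo. Qed.

Lemma content_ins x a b : content a = content b ->
  content (ins x a) = content (ins x b).
Proof.
move=> ab; apply: content_expo; rewrite (perm_trans (expo_ins x a))// perm_sym.
by rewrite (perm_trans (expo_ins x b))// perm_cat2l perm_expo.
Qed.

Lemma content_inter a a' b b' : content a = content a' -> content b = content b' ->
  content (interleave a b) = content (interleave a' b').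
Proof.
move=> aa bb; apply: content_expo; rewrite (perm_trans (expo_inter a b))// perm_sym.
by rewrite (perm_trans (expo_inter _ _))// perm_cat ?perm_expo.
Qed.

(** An additional variable may be adjoined before or after the two alphabets are merged, the
    exponents being the same. This makes the specialization at 1 commute with slices. *)
Lemma content_ins_inter x a b : content (ins x (interleave a b)) =
  content (interleave (ins x a) b).
Proof.
apply: content_expo; rewrite (perm_trans (expo_ins _ _))// perm_sym.
rewrite (perm_trans (expo_inter _ _))//.
apply: (@perm_trans _ (([seq y <- [:: x] | 0 < y] ++ expo a) ++ expo b)).
  by rewrite perm_cat2r expo_ins.
by rewrite -catA perm_cat2l perm_sym expo_inter.
Qed.

Lemma content_interC a b : content (interleave a b) = content (interleave b a).
Proof.
apply: content_expo; rewrite (perm_trans (expo_inter _ _))// perm_sym.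
by rewrite (perm_trans (expo_inter _ _))// perm_catC.
Qed.

Lemma content_inter0 b : content (interleave (mon [::]) b) = content b.
Proof.
apply: content_expo; rewrite (perm_trans (expo_inter _ _))//.
have /perm_size/size0nil -> : perm_eq (expo (mon [::])) [::]; last by [].
by rewrite perm_sym; exact: (expo_word (@supp_mon [::])).
Qed.

End Monomials.

Lemma big_iota_single (V : nmodType) d m (F : nat -> V) : (m <= d)%N ->
  (forall x, x != m -> F x = 0) -> \sum_(x <- iota 0 d.+1) F x = F m.
Proof.
move=> md F0; rewrite (bigD1_seq m) ?iota_uniq ?mem_iota//.
by rewrite /= big1 ?addr0.
Qed.

Section Operators.
Variable K : comPzRingType.
Implicit Types (lam mu : int_part) (a b : monomial) (f : Lambda K) (F : Lambdahat
  K).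

Lemma Lambda_sym f a b : content a = content b -> f a = f b.
Proof. by apply: symmetric_content; have /asboolP[] := LambdaP f. Qed.

(* [plus1 f] is the specialization f(1, x_1, x_2, ...). *)
Definition plus1_series (f : series K) : series K :=
  fun a => \sum_(x \in [set: nat]) f (ins x a).

Lemma plus1_seriesE (f : series K) d a : deg_le d f ->
  plus1_series f a = \sum_(x <- iota 0 d.+1) f (ins x a).
Proof.
move=> fd; rewrite /plus1_series (@fsbigE _ _ _ _ _ (iota 0 d.+1)) ?iota_uniq//.
  by apply: eq_bigl => x; rewrite in_setT.
by move=> x _; rewrite mem_iota /= => dx; apply: fd; rewrite mdeg_ins; lia.
Qed.

Fact plus1_subproof f : plus1_series f \in @in_Lambda K.
Proof.
have [d fd] := deg_le_ex f; apply/asboolP; split.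
  apply: content_symmetric => a b ab; rewrite !(plus1_seriesE _ fd);
    apply: eq_bigr => x _.
  by apply: Lambda_sym; apply: content_ins.
exists d => a da; rewrite (plus1_seriesE _ fd) big1// => x _.
by apply: fd; rewrite mdeg_ins; lia.
Qed.

Definition plus1 f : Lambda K := MkLambda (plus1_subproof f).

Lemma plus1E f d a : deg_le d f -> plus1 f a = \sum_(x <- iota 0 d.+1) f (ins x a).
Proof. exact: plus1_seriesE. Qed.

Fact plus1_lin : linear plus1.
Proof.
move=> u f f'; have [d fd] := deg_le_ex f; have [d' fd'] := deg_le_ex f'.
have {}fd := deg_leW (leq_maxl d d') fd; have {}fd' := deg_leW (leq_maxr d d') fd'.
apply: Lambda_eq => a; rewrite Lambda_linE (plus1E _ fd) (plus1E _ fd').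
rewrite (@plus1E _ (maxn d d')); last first.
  by move=> b da; rewrite Lambda_linE fd// fd'// mulr0 addr0.
by rewrite mulr_sumr -big_split.
Qed.

HB.instance Definition _ := GRing.isLinear.Build K (Lambda K) (Lambda K) *:%R
  plus1 plus1_lin.

Lemma rpp_count_ins lam x a n : supp_le n a ->
  rpp_count (part_cols lam) (content (ins x a)) =
    rpp_count (part_cols lam) (x :: mkseq a n).
Proof. by move=> na; rewrite -(rpp_count_content lam (supp_ins x na)) word_ins. Qed.

Lemma rpp_count_sub k a n : decr k -> supp_le n a ->
  rpp_count (part_cols (part_of_cols k)) (content a) = rpp_count k (mkseq a n).
Proof. by move=> d na; rewrite -(rpp_count_content _ na) rpp_count_part_of_cols.
  Qed.

Lemma gpoly_deg lam : deg_le (sumn lam) (gpoly K lam).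
Proof.
move=> a la; rewrite gpolyE; have := @rpp_count_sumn (part_cols lam) (content a).
rewrite sumn_part_cols -mdeg_content; case: (rpp_count _ _) => // n /(_ isT); lia.
Qed.

(** By symmetry the variable set to 1, first in the word, may be read as the largest entry. Its
    exponent takes all values, so each smaller shape [k] survives exactly once. *)
Lemma plus1_gpoly lam :
  plus1 (gpoly K lam) = \sum_(k <- subcols (part_cols lam)) gpoly K (part_of_cols
    k).
Proof.
apply: Lambda_eq => a; have [n na] := supp_le_ex a.
rewrite (plus1E _ (@gpoly_deg lam)) Lambda_sumE.
under eq_bigr => x _.
  rewrite gpolyE (rpp_count_ins lam x na) /= natr_sum big_mkcond /=.
  over.
rewrite exchange_big; apply: eq_big_seq => k kl.
rewrite gpolyE (rpp_count_sub (subcols_decr kl) na).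
have nl : (ndiff k (part_cols lam) <= sumn lam)%N.
  by have := ndiff_sumn (subcols_ptleq kl); rewrite sumn_part_cols; lia.
rewrite (big_iota_single nl) ?eqxx// => x.
by rewrite eq_sym => /negbTE->.
Qed.

Lemma schurE lam a : schur K lam a = if mdeg a == sumn lam then kostka K lam
  (content a) else 0.
Proof. exact: schur_seriesE. Qed.

Lemma schur_deg lam : deg_le (sumn lam) (schur K lam).
Proof. by move=> a la; rewrite schurE (gtn_eqF la). Qed.

(** Homogeneity leaves one exponent for the variable set to 1, the size of [lam] minus the degree of
    [a]; [rpp_count_strip] then restricts the removals to horizontal strips. *)
Lemma plus1_schur lam :
  plus1 (schur K lam) =
  \sum_(k <- subcols (part_cols lam) | strip k (part_cols lam)) schur K
    (part_of_cols k).
Proof.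
apply: Lambda_eq => a; have [n na] := supp_le_ex a.
rewrite (plus1E _ (@schur_deg lam)) Lambda_sumE.
have R : \sum_(k <- subcols (part_cols lam) | strip k (part_cols lam)) schur K
  (part_of_cols k) a =
    \sum_(k <- subcols (part_cols lam) | strip k (part_cols lam) &&
      (sumn k == sumn (mkseq a n)))
      (rpp_count k (mkseq a n))%:R.
  rewrite big_mkcond [RHS]big_mkcond; apply: eq_big_seq => k kl.
  rewrite schurE sumn_part_of_cols ?(subcols_decr kl)// /kostka (rpp_count_sub
    (subcols_decr kl) na).
  by rewrite (mdeg_word na) eq_sym; case: strip; case: eqP.
rewrite R; case: (leqP (mdeg a) (sumn lam)) => al.
  rewrite (big_iota_single (leq_subr (mdeg a) (sumn lam))) => [|x xl]; last first.
    rewrite schurE mdeg_ins; case: eqP => // xa; case/eqP: xl; lia.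
  rewrite schurE mdeg_ins subnK// eqxx /kostka (rpp_count_ins _ _ na)
    rpp_count_strip.
    by rewrite natr_sum.
  by rewrite /= -(mdeg_word na) subnK// sumn_part_cols.
rewrite big1 => [|x _]; last by rewrite schurE mdeg_ins; case: eqP => // xa; lia.
rewrite big_seq_cond big1// => k /andP[/subcols_ptleq/ptleq_sumn kl /andP[_ /eqP
  ka]].
by move: kl; rewrite ka -(mdeg_word na) sumn_part_cols; lia.
Qed.

Lemma schur_ind (P : Lambda K -> Prop) :
  P 0 -> (forall u f f', P f -> P f' -> P (u *: f + f')) ->
  (forall lam, P (schur K lam)) -> forall f, P f.
Proof.
move=> P0 Plin Ps f; have [d /schur_expand ->] := deg_le_ex f.
elim: (parts_le d) => [|lam s IH]; first by rewrite big_nil.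
by rewrite big_cons; apply: Plin.
Qed.

(** The [g_lambda] span: subtracting the top-degree Schur expansion of [f], with each [s_lambda]
    replaced by [g_lambda], lowers the degree. *)
Lemma gpoly_ind (P : Lambda K -> Prop) :
  P 0 -> (forall u f f', P f -> P f' -> P (u *: f + f')) ->
  (forall lam, P (gpoly K lam)) -> forall f, P f.
Proof.
move=> P0 Plin Pg f; have [d fd] := deg_le_ex f.
(* The degree bound is made strict so that the induction starts from [f = 0]. *)
have {fd} : forall a, (d.+1 <= mdeg a)%N -> f a = 0 by exact: fd.
move: d.+1 => {}d; elim: d f => [|d IH] f fd.
  have -> // : f = 0 by apply: Lambda_eq => a; rewrite fd.
pose h := \sum_(lam <- parts_of d) schur_coef (hat f) lam *: gpoly K lam.
have Ph : P h.
  rewrite /h; elim: (parts_of d) => [|lam s IHs]; first by rewrite big_nil.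
  by rewrite big_cons; apply: Plin.
rewrite -(subrK h f) -[f - h]scale1r; apply: Plin => //; apply: IH => a da.
have -> : (f - h) a = f a - h a by [].
rewrite Lambda_sumE; move: da; rewrite leq_eqVlt => /orP[/eqP da|da].
  apply/eqP; rewrite subr_eq0; apply/eqP.
  rewrite -[LHS]/(hat f a) schur_coefE -da; apply: eq_bigr => lam _.
  by rewrite -[RHS]/(_ * gpoly K lam a) gpolyE.
rewrite fd// big_seq big1 ?subrr// => lam; rewrite mem_parts_of => /eqP ld.
by rewrite -[LHS]/(_ * gpoly K lam a) gpoly_deg ?mulr0// ld.
Qed.

(** * Elementary symmetric functions and the series [E(-1)] *)

Definition ones d : int_part := part_of_cols [:: d].

Lemma onesE d : ones d = nseq d 1%N :> seq nat.
Proof.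
rewrite part_of_colsE//; apply: (@eq_from_nth _ 0%N);
  rewrite size_cols ?size_nseq// => i id.
by rewrite nth_cols// nth_nseq id /=; move: id => /= ->.
Qed.

Lemma sumn_ones d : sumn (ones d) = d.
Proof. by rewrite sumn_part_of_cols//= addn0. Qed.

(** An entry meets at most the one column there is, so a positive part can only be 1. *)
Lemma rpp_count_column d al : all (leq 1) al -> sumn al = d ->
  rpp_count [:: d] al = all (pred1 1%N) al.
Proof.
elim: al d => [|x al IH] d /=; first by move=> _ <-.
move=> /andP[x1 al1] E.
have d0 : (0 < d)%N by lia.
rewrite -[X in X = _]/(rpp_count [:: d] (x :: al)).
have c1 : count (leq 1) [:: d] = 1%N by rewrite /= d0.
case: (ltngtP x 1) => [|x2|xE]; first lia.
  by rewrite rpp_count_big ?c1//; case: eqP => //; lia.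
rewrite xE; have -> : rpp_count [:: d] (1%N :: al) = rpp_count [:: d.-1] al.
  by rewrite -{1}c1 rpp_count_max// c1 /=; lia.
rewrite IH//; lia.
Qed.

Lemma kostka_ones d a : mdeg a = d -> kostka K (ones d) (content a) =
  e_series K d a.
Proof.
move=> da; rewrite /kostka rpp_count_part_of_cols// rpp_count_column ?part_pos
  -?mdeg_content// /e_series da eqxx andbT.
congr (_%:R); congr nat_of_bool; apply/idP/asboolP => [/allP h k|h].
  case: (finsuppP a k) => // ka.
  have : a k \in parts (content a) by rewrite (perm_mem (perm_content a));
    apply/mapP; exists k => //.
  by move/h => /eqP->.
apply/allP => x; rewrite (perm_mem (perm_content a)) => /mapP[k + ->].
by rewrite mem_finsupp /=; have := h k; case: (a k) => [|[]].
Qed.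

Lemma big_parts_ones (c : int_part -> K) i a :
  \sum_(lam <- parts_of (mdeg a)) (c lam * (lam == ones i)%:R) * kostka K lam
    (content a) =
  c (ones i) * e_series K i a.
Proof.
case: (eqVneq (mdeg a) i) => [ai|ia].
  rewrite (bigD1_seq (ones i)) ?uniq_parts_of ?mem_parts_of ?sumn_ones ?ai//=.
  rewrite eqxx mulr1 kostka_ones// big1 ?addr0// => lam /negbTE->.
  by rewrite mulr0 mul0r.
rewrite /e_series (negbTE ia) andbF mulr0 big_seq big1// => lam.
rewrite mem_parts_of => /eqP la; case: eqP => [li|]; rewrite ?mulr0 ?mul0r//.
by case/eqP: ia; rewrite -la li sumn_ones.
Qed.

Lemma schur_coef_elemsym i lam : schur_coef (hat (elemsym K i)) lam =
  (lam == ones i)%:R.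
Proof.
apply: (schur_coefP (c := fun lam => (lam == ones i)%:R)) => a.
rewrite -[LHS]/(e_series K i a) -[LHS]mul1r -[LHS](big_parts_ones (fun=> 1)).
by apply: eq_bigr => mu _; rewrite mul1r.
Qed.

Definition sgn_ones lam : K := (-1) ^+ sumn lam * (lam == ones (sumn lam))%:R.

Lemma Eneg1E a : Eneg1 K a = (-1) ^+ mdeg a * e_series K (mdeg a) a.
Proof.
rewrite -[LHS]/(\sum_(i \in [set: nat]) (-1) ^+ i * e_series K i a).
rewrite (@fsbigE _ _ _ _ _ [:: mdeg a])//.
  by rewrite big_mkcond big_seq1 in_setT.
by move=> i _; rewrite inE eq_sym /e_series => /negbTE->; rewrite andbF mulr0.
Qed.

Lemma schur_coef_Eneg1 lam : schur_coef (Eneg1 K) lam = sgn_ones lam.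
Proof.
apply: (schur_coefP (c := sgn_ones)) => a; rewrite Eneg1E.
have := @big_parts_ones (fun=> (-1) ^+ mdeg a) (mdeg a) a => <-.
by apply: eq_big_seq => mu; rewrite mem_parts_of /sgn_ones => /eqP->.
Qed.

Lemma sgn_ones_part_of_cols y r : decr (y :: r) ->
  sgn_ones (part_of_cols (y :: r)) = (-1) ^+ y * (all (pred1 0%N) r)%:R.
Proof.
move=> d; rewrite /sgn_ones sumn_part_of_cols//.
case: (boolP (all (pred1 0%N) r)) => [z|nz].
  have zr : sumn r = 0%N.
    by elim: (r) z => //= x s IH /andP[/eqP-> /IH ->].
  have -> : part_of_cols (y :: r) = ones (sumn (y :: r)).
    apply: val_inj; rewrite /= onesE part_of_colsE//= zr addn0.
    apply: (@eq_from_nth _ 0%N); rewrite size_cols ?size_nseq// => i iy.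
    rewrite nth_cols// nth_nseq iy /= iy; suff -> : count (leq i.+1) r = 0%N by [].
    apply/eqP; rewrite -leqn0 leqNgt -has_count -all_predC;
      apply/allP => x /(allP z).
    by move=> /eqP->.
  by rewrite eqxx /= zr addn0.
case: eqP => [E|_]; last by rewrite !mulr0.
(* A second nonempty column would give the first row two boxes, whereas all parts of [ones] are
   1. *)
have [x xr x0] : exists2 x, x \in r & (0 < x)%N.
  move: nz; rewrite -has_predC => /hasP[x xr /=]; rewrite -lt0n; by exists x.
have := congr1 (fun m : int_part => nth 0%N m 0) E.
rewrite onesE part_of_colsE// nth_nseq /=.
move: d; rewrite /decr /= decr_path => /andP[/allP/(_ _ xr) /= xy _].
have y0 : (0 < y)%N by apply: leq_trans xy.
rewrite nth_cols//= y0 /= (_ : (0 < y + sumn r)%N); last lia.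
rewrite add1n => -[c0]; suff : has (leq 1) r by rewrite has_count c0.
by apply/hasP; exists x.
Qed.

(** Only single columns count. A horizontal strip leaves one only if every further column has at
    most one box, and it then either keeps the first column or takes its last box; the two results
    have opposite signs. *)
Lemma sum_sgn_strip k : decr k -> (0 < head 0 k)%N ->
  \sum_(k' <- subcols k | strip k' k) sgn_ones (part_of_cols k') = 0.
Proof.
case: k => [|l kr] // d /= l0; set z := nseq (size kr) 0%N.
have dz y : decr (y :: z) by rewrite /z; elim: (size kr) y => //= n IH y;
  exact: (IH 0%N).
have lz : ptleq z kr by rewrite /z; elim: (kr) => //= x s ->.
have mz y : (y <= l)%N -> (y :: z) \in subcols (l :: kr).
  by move=> yl; rewrite mem_subcols dz /= yl.
have ndz : (ndiff z kr <= sumn kr)%N.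
  by have := ndiff_sumn lz; rewrite sumn_nseq mul0n addn0.
(* The condition says that all columns after the first have at most one box. *)
pose s := if ndiff z kr == sumn kr then [:: l :: z; l.-1 :: z] else [::].
have stz y : (y <= l)%N -> strip (y :: z) (l :: kr) =
  (ndiff z kr == sumn kr) && (l.-1 <= y)%N.
  move=> yl; rewrite /strip /= sumn_nseq mul0n addn0 /ndiff /= -/(ndiff z kr).
  by case: ltnP => //=; lia.
transitivity (\sum_(k' <- s) sgn_ones (part_of_cols k')); last first.
  rewrite /s; case: eqP => _; last by rewrite big_nil.
  rewrite big_cons big_seq1 !sgn_ones_part_of_cols ?dz//.
  have -> : all (pred1 0%N) z by exact: all_pred1_nseq.
  by rewrite !mulr1 -{1}(prednK l0) exprS mulN1r addNr.
rewrite -big_filter (bigID (fun k' => all (pred1 0%N) (behead k'))) /=.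
rewrite [X in _ + X]big_seq_cond [X in _ + X]big1 ?addr0; last first.
  move=> [|y r]; first by rewrite andbF.
  rewrite mem_filter => /andP[/andP[_ /subcols_decr dy] /= /negbTE nz].
  by rewrite sgn_ones_part_of_cols// nz mulr0.
rewrite -big_filter; apply: perm_big; apply: uniq_perm.
- exact/filter_uniq/filter_uniq/uniq_subcols.
- rewrite /s; case: eqP => //= _; rewrite inE andbT; apply/eqP => -[]; lia.
move=> k'; rewrite !mem_filter; apply/idP/idP.
  case: k' => [|y r] /and3P[/all_pred1P rz st kl].
    by have := ptleq_size (subcols_ptleq kl).
  have /= yl := subcols_ptleq kl; have sr := ptleq_size (subcols_ptleq kl).
  have {rz} rz : r = z by rewrite /= in rz; rewrite rz /z; case: sr => ->.
  subst r; have /andP[{}yl _] := yl.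
  move: st; rewrite stz// => /andP[e ly]; rewrite /s e !inE !eqseq_cons !eqxx
    !andbT.
  by lia.
rewrite /s; case: ifP => // e; rewrite !inE => /orP[] /eqP->.
  by rewrite /= all_pred1_nseq stz// e mz// leq_pred.
by rewrite /= all_pred1_nseq stz ?leq_pred// e mz ?leq_pred//= leqnn.
Qed.

Definition const_coef f : K := f (mon [::]).

Lemma content_mon0 : content (mon [::]) = part_empty.
Proof. exact: (content_mon part_empty). Qed.

Lemma sumn_part_eq0 lam : (sumn lam == 0%N) = (lam == part_empty).
Proof.
apply/eqP/eqP => [l0|->//]; apply: val_inj => /=.
by apply: size0nil; have := part_size lam; rewrite l0; lia.
Qed.

Lemma const_coef_schur lam : const_coef (schur K lam) = (lam == part_empty)%:R.
Proof.
rewrite /const_coef schurE mdeg_content content_mon0 -sumn_part_eq0 eq_sym.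
by case: eqP => // /eqP; rewrite sumn_part_eq0 => /eqP->; rewrite kostka_diag.
Qed.

Lemma const_coef_gpoly lam : const_coef (gpoly K lam) = (lam == part_empty)%:R.
Proof.
rewrite /const_coef gpolyE content_mon0 -sumn_part_eq0 -sumn_part_cols;
  congr (_%:R).
rewrite -[LHS]/(nat_of_bool (all (pred1 0%N) (part_cols lam))); congr nat_of_bool.
by elim: (part_cols lam) => //= x s ->; rewrite addn_eq0.
Qed.

(** By linearity only Schur functions matter, and for a nonempty shape the terms cancel by
    [sum_sgn_strip]. *)
Lemma hall_Eneg1_plus1 f : hall (Eneg1 K) (plus1 f) = const_coef f.
Proof.
elim/schur_ind: f => [|u f f' IH IH'|lam].
- by rewrite linear0 hall0.
- by rewrite linearP hall_lin IH IH'.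
rewrite plus1_schur hall_sum const_coef_schur.
under eq_bigr do rewrite hall_schur schur_coef_Eneg1.
case: eqP => [->|/eqP ne].
  rewrite /part_cols /= big_mkcond /subcols /= big_seq1 /strip /=.
  rewrite /sgn_ones sumn_part_of_cols//= expr0 mul1r (_ : (_ == _) = true)//.
  by apply/eqP/val_inj; exact: etrans (@part_of_colsE [::] isT) (esym (onesE 0)).
rewrite sum_sgn_strip ?decr_part_cols//.
move: ne; rewrite -sumn_part_eq0 /part_cols; have := part_pos lam.
by case: (parts lam) => // x s /andP[x0 _] _; case: x x0.
Qed.

(** * Slices of the coproduct and the operators [perp] *)

Fact slice_subproof f b : (fun a => f (interleave a b)) \in @in_Lambda K.
Proof.
apply/asboolP; split.
  by apply: content_symmetric => a a' aa'; apply: Lambda_sym; apply: content_inter.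
have [d fd] := deg_le_ex f; exists d => a da; apply: fd.
by rewrite mdeg_inter; lia.
Qed.

(* The coefficient of y^b in f(x, y), as an element of Lambda in x. *)
Definition slice f b : Lambda K := MkLambda (slice_subproof f b).

Lemma slice_deg f b d : deg_le d f -> deg_le d (slice f b).
Proof. by move=> fd a da; apply: fd; rewrite mdeg_inter; lia. Qed.

Fact monosym_subproof lam : (fun a => (content a == lam)%:R) \in @in_Lambda K.
Proof.
apply/asboolP; split; first by apply: content_symmetric => a b ->.
by exists (sumn lam) => a la; case: eqP => // al; move: la;
  rewrite mdeg_content al ltnn.
Qed.

Definition monosym lam : Lambda K := MkLambda (monosym_subproof lam).

(** In terms of the monomial symmetric functions in [y], the coefficient of [monosym lam] is the
    slice at [mon lam]; at [b] only the partition [content b] contributes. *)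
Lemma coprod_exists f : exists s, is_coprod f s.
Proof.
have [d fd] := deg_le_ex f.
exists [seq (slice f (mon lam), monosym lam) | lam : int_part <- parts_le d] => a b.
rewrite big_map /coprod.
rewrite (big_parts_le _ (m := mdeg b)) => [|lam lb]; last first.
  rewrite -[X in _ * X]/((content b == lam)%:R); case: eqP => [bl|];
    rewrite ?mulr0//.
  by move: lb; rewrite mdeg_content bl eqxx.
case: leqP => bd; last by rewrite fd// mdeg_inter; lia.
rewrite (bigD1_seq (content b)) ?uniq_parts_of ?mem_parts_of ?mdeg_content//=.
rewrite eqxx mulr1 big1 ?addr0 => [|lam].
  by apply: Lambda_sym; apply: content_inter => //;
    exact: esym (content_mon (content b)).
by rewrite eq_sym => /negbTE->; rewrite mulr0.
Qed.

(** For any decomposition the slice is the combination of the [p.1] with coefficients [p.2 b], so by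
    linearity of the pairing the choice of decomposition does not matter. *)
Lemma perpE F f b : perp F f b = hall F (slice f b).
Proof.
rewrite /perp; case: xgetP => [s _ /= H|H]; last first.
  by have [s sf] := coprod_exists f; case: (H s).
rewrite Lambda_sumE.
have -> : slice f b = \sum_(p <- s) p.2 b *: p.1.
  apply: Lambda_eq => a; rewrite Lambda_sumE -[LHS]/(coprod f a b) H.
  by apply: eq_bigr => p _; rewrite mulrC.
by rewrite hall_sum; apply: eq_bigr => p _; rewrite hallZ mulrC.
Qed.

Lemma slice_plus1 f b : slice (plus1 f) b = plus1 (slice f b).
Proof.
have [d fd] := deg_le_ex f; apply: Lambda_eq => a.
rewrite -[LHS]/(plus1 f (interleave a b)) (plus1E _ fd) (plus1E _ (@slice_deg f b
  d fd)).
by apply: eq_bigr => x _; apply: Lambda_sym; apply: content_ins_inter.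
Qed.

Lemma const_coef_slice f b : const_coef (slice f b) = f b.
Proof. exact: (Lambda_sym f (content_inter0 b)). Qed.

(** Coefficientwise, [E(-1)] extracts the constant term of the slice at [b], which is the
    coefficient of [f] at [b]. *)
Lemma perp_plus1 f : perp (Eneg1 K) (plus1 f) = f.
Proof.
by apply: Lambda_eq => b; rewrite perpE slice_plus1 hall_Eneg1_plus1
  const_coef_slice.
Qed.

Lemma plus1_perp f : plus1 (perp (Eneg1 K) f) = f.
Proof.
have [d fd] := deg_le_ex f; have [d' fd'] := deg_le_ex (perp (Eneg1 K) f).
have {}fd := deg_leW (leq_maxl d d') fd; have {}fd' := deg_leW (leq_maxr d d') fd'.
apply: Lambda_eq => b; rewrite (plus1E _ fd').
under eq_bigr do rewrite perpE.
rewrite -hall_sum -(const_coef_slice f b) -hall_Eneg1_plus1; congr hall.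
(* By the symmetry of [f], the variable set to 1 can be moved from the alphabet [y] to the alphabet
   [x]. *)
apply: Lambda_eq => a; rewrite Lambda_sumE (plus1E _ (@slice_deg f b _ fd)).
apply: eq_bigr => x _.
rewrite -[LHS]/(f (interleave a (ins x b))) -[RHS]/(f (interleave (ins x a) b)).
apply: Lambda_sym; by rewrite content_interC -content_ins_inter (content_ins _
  (content_interC _ _)) content_ins_inter.
Qed.

(** * Pairings with the [g_lambda] and the series [G_(1)] *)

Lemma sum_indicator (X : eqType) (s : seq X) x : uniq s ->
  \sum_(y <- s) (y == x)%:R = (x \in s)%:R :> K.
Proof.
move=> us; case: (boolP (x \in s)) => xs.
  by rewrite (bigD1_seq x)//= eqxx big1 ?addr0// => y /negbTE->.
by rewrite big_seq big1// => y ys; case: eqP => // yx; move: xs; rewrite -yx ys.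
Qed.

Lemma plus1_gpoly_subparts lam : plus1 (gpoly K lam) =
  \sum_(mu <- subparts lam) gpoly K mu.
Proof. by rewrite plus1_gpoly /subparts big_map. Qed.

Lemma part_sub_sumn mu lam : part_sub mu lam -> mu != lam -> (sumn mu < sumn lam)%N.
Proof.
move=> /mem_subparts/mapP[k kl ->] ne; have d := subcols_decr kl;
  rewrite sumn_part_of_cols// -sumn_part_cols.
have := ndiff_sumn (subcols_ptleq kl); have := ndiff_eq0 (subcols_ptleq kl).
case: (ndiff _ _) => [/esym/eqP E|n _]; last lia.
by case/eqP: ne; rewrite E colsK_part.
Qed.

(** The pairings, summed over all shapes inside [mu], give the constant term of [g_mu]. This
    recurrence determines them by induction on the size. *)
Lemma hall_Eneg1_gpoly mu :
  hall (Eneg1 K) (gpoly K mu) = (mu == part_empty)%:R - (mu == part_one)%:R.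
Proof.
have [n] := ubnP (sumn mu); elim: n mu => // n IH mu; rewrite ltnS => mun.
have mm : mu \in subparts mu by apply/mem_subparts => i.
have := hall_Eneg1_plus1 (gpoly K mu).
rewrite plus1_gpoly_subparts hall_sum const_coef_gpoly.
rewrite (bigD1_seq mu) ?uniq_subparts//= => E.
(* The claimed values obey the same recurrence: every shape contains the empty one, and every
   nonempty shape contains the single box. *)
have E' : \sum_(nu <- subparts mu) ((nu == part_empty)%:R - (nu == part_one)%:R) =
    (mu == part_empty)%:R :> K.
  rewrite sumrB !sum_indicator ?uniq_subparts//.
  have -> : part_empty \in subparts mu by apply/mem_subparts => i; rewrite nth_nil.
  suff -> : (part_one \in subparts mu) = (mu != part_empty) by case: eqP;
    rewrite ?subr0 ?subrr.
  apply/idP/idP => [/mem_subparts/(_ 0%N)|].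
    by apply: contraTN => /eqP->; rewrite -ltnNge nth_nil.
  rewrite -sumn_part_eq0 => m0; apply/mem_subparts => -[|i] /=;
    last by rewrite nth_nil.
  have := part_pos mu; case: (parts mu) m0 => //= x s _ /andP[].
  by [].
move: E'; rewrite (bigD1_seq mu) ?uniq_subparts//=; set S := \sum_(i <- _ | _) _.
rewrite -{}E (_ : \sum_(i <- _ | _) _ = S); first by move/addIr.
rewrite big_seq_cond /S [RHS]big_seq_cond; apply: eq_bigr => nu
  /andP[/mem_subparts nm ne].
by apply: IH; apply: leq_trans (part_sub_sumn nm ne) mun.
Qed.

Lemma schur_coef_onehat lam : schur_coef (onehat K) lam = (lam == part_empty)%:R.
Proof.
have -> : part_empty = ones 0 by apply: val_inj; rewrite /= onesE.
rewrite -schur_coef_elemsym; congr schur_coef; apply: val_inj; apply/funext => a.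
rewrite -[LHS]/((mdeg a == 0%N)%:R) -[RHS]/(e_series K 0 a) /e_series.
case: eqP => [a0|]; rewrite ?andbF// andbT; case: asboolP => // -[] k.
by rewrite (mdeg_eq0I a0) cm1.
Qed.

Lemma hall_onehat f : hall (onehat K) f = const_coef f.
Proof.
elim/schur_ind: f => [|u f f' IH IH'|lam]; first by rewrite hall0.
  by rewrite hall_lin IH IH'.
by rewrite hall_schur schur_coef_onehat const_coef_schur.
Qed.

(** The [g_mu] span, so pairings with them determine all others, in particular the Schur
    coefficients. This identifies the choice made in [Gpoly]. *)
Lemma hall_gpoly_inj F F' :
  (forall mu, hall F (gpoly K mu) = hall F' (gpoly K mu)) -> F = F'.
Proof.
move=> E; apply: Lambdahat_eq => lam; rewrite -!hall_schur.
elim/gpoly_ind: (schur K lam) => [|u f f' IH IH'|mu]; first by rewrite !hall0.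
  by rewrite !hall_lin IH IH'.
exact: E.
Qed.

Lemma hall_subl F F' f : hall (F - F') f = hall F f - hall F' f.
Proof.
by rewrite addrC -scaleN1r hall_linl mulN1r addrC.
Qed.

Lemma Gpoly_one : Gpoly K part_one = onehat K - Eneg1 K.
Proof.
have H mu : hall (onehat K - Eneg1 K) (gpoly K mu) = (part_one == mu)%:R.
  rewrite hall_subl hall_onehat const_coef_gpoly hall_Eneg1_gpoly.
  by rewrite subKr eq_sym.
rewrite /Gpoly; case: xgetP => [F _ /= FE|/(_ (onehat K - Eneg1 K))[]//].
by apply: hall_gpoly_inj => mu; rewrite FE H.
Qed.

Lemma hall_elemsym i f : hall (hat (elemsym K i)) f = schur_coef (hat f) (ones i).
Proof.
elim/schur_ind: f => [|u f f' IH IH'|lam].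
- rewrite hall0; have -> : hat (0 : Lambda K) = 0 by apply: val_inj.
  by rewrite -[0 in RHS](scale0r (0 : Lambdahat K)) -[_ *: _]addr0 schur_coef_lin
    mul0r add0r;
     rewrite (@schur_coefP _ 0 (fun=> 0))// => a; rewrite big1// => lam _;
       rewrite mul0r.
- have -> : hat (u *: f + f') = u *: hat f + hat f' by apply: val_inj.
  by rewrite hall_lin IH IH' schur_coef_lin.
by rewrite hall_schur schur_coef_elemsym schur_coef_schur eq_sym.
Qed.

(** At each [lam] only the index [i] equal to its size contributes, and this is at most [d]. *)
Lemma hall_Eneg1 f d : deg_le d f ->
  hall (Eneg1 K) f = \sum_(i <- iota 0 d.+1) (-1) ^+ i * hall (hat (elemsym K i)) f.
Proof.
move=> fd; rewrite (hallE _ fd).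
under [RHS]eq_bigr do rewrite (hallE _ fd) mulr_sumr.
rewrite exchange_big; apply: eq_big_seq => lam; rewrite mem_parts_le => ld.
rewrite (big_iota_single ld) => [|i il].
  by rewrite schur_coef_Eneg1 schur_coef_elemsym mulrA.
rewrite schur_coef_elemsym.
case: eqP => [li|]; last by rewrite mul0r mulr0.
by case/eqP: il; rewrite li sumn_ones.
Qed.

(** The slices of [f] have degree at most [d], so each [e_i] with [i > d] pairs to zero with them
    and the infinite sum is finite. *)
Lemma perp_Eneg1_sum f :
  perp (Eneg1 K) f = \sum_(i \in [set: nat]) (-1) ^+ i *: perp (hat (elemsym K
    i)) f.
Proof.
have [d fd] := deg_le_ex f.
rewrite (@fsbigE _ _ _ _ _ (iota 0 d.+1)) ?iota_uniq//.
  apply: Lambda_eq => b; rewrite perpE (hall_Eneg1 (slice_deg b fd)).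
  rewrite (eq_bigl xpredT) => [|i]; last by rewrite in_setT.
  rewrite Lambda_sumE; apply: eq_bigr => i _.
  by rewrite -perpE.
move=> i _; rewrite mem_iota /= => di.
have -> : perp (hat (elemsym K i)) f = 0; last by rewrite scaler0.
apply: Lambda_eq => b; rewrite perpE hall_elemsym (schur_coef_deg (d := d))//.
  exact: slice_deg.
by rewrite sumn_ones; lia.
Qed.

End Operators.

Unset Implicit Arguments.

Theorem theorem4p8 (K : comPzRingType) :
  Eneg1 K = onehat K - Gpoly K part_one /\
  exists I : {linear Lambda K -> Lambda K},
    [/\ forall lam : int_part,
          I (gpoly K lam) = \sum_(mu \in [set mu | part_sub mu lam]) gpoly K mu,
        forall J : {linear Lambda K -> Lambda K},
          (forall lam : int_part,
             J (gpoly K lam) = \sum_(mu \in [set mu | part_sub mu lam]) gpoly K mu) ->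
          J =1 I
      & exists Iinv : Lambda K -> Lambda K,
          [/\ cancel I Iinv, cancel Iinv I,
              Iinv =1 perp (Eneg1 K),
              Iinv =1 (fun f => f - perp (Gpoly K part_one) f)
            & Iinv =1 (fun f =>
                \sum_(i \in [set: nat]) (-1) ^+ i *: perp (hat (elemsym K i)) f)]].
Proof.
split; first by rewrite Gpoly_one opprB addrC subrK.
have IE (lam : int_part) : plus1 (gpoly K lam) =
    \sum_(mu \in [set mu | part_sub mu lam]) gpoly K mu.
  by rewrite set_subparts -fsbig_seq ?uniq_subparts// plus1_gpoly_subparts.
exists (plus1 (K:=K)); split=> //.
  (* A linear map is determined by its values on the [g_lambda], which span. *)
  move=> J JE f; elim/gpoly_ind: f => [|u f f' IH IH'|lam]; last by rewrite JE -IE.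
    by rewrite !linear0.
  by rewrite !linearP IH IH'.
exists (perp (Eneg1 K)); split=> //.
- exact: perp_plus1.
- exact: plus1_perp.
(* The identity is [perp] of the series 1: pairing 1 with the slice at [b] gives its constant term,
   which is [f b]. *)
- move=> f; apply: Lambda_eq => b.
  have -> : (f - perp (Gpoly K part_one) f) b = f b - perp (Gpoly K part_one) f b by [].
  rewrite !perpE Gpoly_one hall_subl hall_onehat const_coef_slice.
  by rewrite opprB addrC subrK.
- exact: perp_Eneg1_sum.
Qed.
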